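(* Let $A$ be a unital commutative $\mathbb R$-algebra with $X(A)\neq\varnothing$, and let $L:A\to\mathbb R$ be a linear functional with $L(1)=1$. The following conditions are equivalent: (i) for every $a\in A$ there is a compact set $K_a\subset\mathbb R$ and a unique positive Radon measure $\mu_a$ on $K_a$ such that $$L(a^n)=\int_{K_a}x^n\,d\mu_a(x)\quad\text{for all } n\in\mathbb N_0;$$ (ii) $L$ is positive semidefinite and $v_L(a)<\infty$ for all $a\in A$; (iii) there is a compact set $K\subseteq X(A)$ and a unique positive Radon measure $\mu$ on $K$ such that $$L(a)=\int_K\alpha(a)\,d\mu(\alpha)\quad\text{for all } a\in A;$$ moreover $$\operatorname{supp}\mu\subseteq\{\alpha\in X(A):|\alpha(a)|\le v_L(a)\text{ for all }a\in A\}.$$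
   Context: $\mathbb N_0=\{0,1,2,\dots\}$. For a unital commutative $\mathbb R$-algebra $A$, $X(A)$ denotes the set of all (unital) $\mathbb R$-algebra homomorphisms $A\to\mathbb R$, endowed with the topology of pointwise convergence. A linear functional $L:A\to\mathbb R$ is positive semidefinite if $L(a^2)\ge 0$ for all $a\in A$. For a positive semidefinite $L$ with $L(1)=1$ and $a\in A$ (with $a^0=1$), define $$v_L(a)=\sqrt{\sup_{n\in\mathbb N_0,\ L(a^{2n})\ne 0}\frac{L(a^{2n+2})}{L(a^{2n})}}\in[0,\infty],$$ with $v_L(a)=\infty$ when the supremum is $\infty$. (A functional $L$ as in (iii) is automatically positive semidefinite, so $v_L$ makes sense there.) *)

(* Defs.v *)
From HB Require Import structures.
From mathcomp Require Import all_boot all_order all_algebra.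
From mathcomp Require Import all_classical all_reals all_analysis.

Set Implicit Arguments.
Unset Strict Implicit.
Unset Printing Implicit Defensive.

Import Order.TTheory GRing.Theory Num.Theory.
Import numFieldNormedType.Exports.

Local Open Scope classical_set_scope.
Local Open Scope ring_scope.

HB.instance Definition _ (I : Type) (T : I -> ptopologicalType) :=
  isPointed.Build (prod_topology T) (fun=> point).

Definition borel (T : ptopologicalType) := g_sigma_algebraType (@open T).

Section radon.
Context {R : realType} {T : ptopologicalType}.
Implicit Types (K : set T) (mu : {measure set (borel T) -> \bar R}).

Definition radon mu : Prop :=
  (forall C : set T, compact C -> (mu C < +oo)%E) /\
  (forall B : set T, measurable (B : set (borel T)) ->
    mu B = ereal_sup [set mu C | C in [set C : set T | compact C /\ C `<=` B]]).

(* Measurable types of the library are pointed, so a Radon measure on the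
   compact set [K] is represented by its image under the inclusion of [K] in the
   ambient Hausdorff space [T], i.e., by a Radon measure on [T] that vanishes
   off [K]. *)
Definition radon_on K mu : Prop := radon mu /\ mu (~` K) = 0%E.

(* The library's measures are functions on arbitrary sets, with no constraint on
   nonmeasurable ones; hence uniqueness is on Borel sets only. *)
Definition unique_radon_on K (P : {measure set (borel T) -> \bar R} -> Prop)
    mu : Prop :=
  [/\ radon_on K mu, P mu &
      forall nu : {measure set (borel T) -> \bar R}, radon_on K nu -> P nu ->
        forall B : set (borel T), measurable B -> nu B = mu B].

Definition msupport mu : set T :=
  [set x | forall U : set T, open U -> U x -> (0 < mu U)%E].

End radon.

Section functionals.
Context {R : realType} {A : comAlgType R}.
Implicit Types (L : {scalar A}) (a : A).

(* X(A), inside the space of all maps from A to R with the topology of pointwise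
   convergence. *)
Definition characters : set {ptws A -> R} :=
  range (fun f : {lrmorphism A -> R | *%R} => (f : A -> R)).

Definition psd L : Prop := forall a, 0 <= L (a ^+ 2).

Definition vL L a : \bar R :=
  sqrte (ereal_sup
    [set (L (a ^+ (2 * n + 2)) / L (a ^+ (2 * n)))%:E |
      n in [set n : nat | L (a ^+ (2 * n)) != 0]]).

Definition is_moment_measure L a (K : set R)
    (mu : {measure set (borel R) -> \bar R}) : Prop :=
  forall n : nat, (L (a ^+ n))%:E = (\int[mu]_(x in K) (x ^+ n)%:E)%E.

Definition is_representing_measure L (K : set {ptws A -> R})
    (mu : {measure set (borel {ptws A -> R}) -> \bar R}) : Prop :=
  forall a, (L a)%:E = (\int[mu]_(alpha in K) (alpha a)%:E)%E.

Definition unique_representation L (K : set {ptws A -> R})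
    (mu : {measure set (borel {ptws A -> R}) -> \bar R}) : Prop :=
  [/\ K `<=` characters, compact K &
      unique_radon_on K (is_representing_measure L K) mu].

End functionals.

Arguments characters {R} A.

(* Main.v *)
Require Import Defs.
From HB Require Import structures.
From mathcomp Require Import all_boot all_order all_algebra.
From mathcomp Require Import all_classical all_reals all_analysis.
From mathcomp Require Import measurable_realfun.
From mathcomp Require Import finmap ring lra zify.

Set Implicit Arguments.
Unset Strict Implicit.
Unset Printing Implicit Defensive.

Import Order.TTheory GRing.Theory Num.Theory.
Import numFieldNormedType.Exports.

Local Open Scope classical_set_scope.
Local Open Scope ring_scope.

(* The heart is (ii) => (iii). Call [w] a weight if [L (w * x^2) >= 0] for all
   [x]. For a weight [w] the sequence [L (w * x^(2n))] is log-convex, so the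
   growth bound [L (x^(2n)) <= v_L(x)^(2n)] forces [|L (w * x)| <= v_L(x) * L w].
   Hence the elements of [A] mapping weights to weights form an archimedean
   semiring on which [L] is nonnegative, and Zorn's lemma applied to the modules
   over this semiring (Kadison-Dubois) turns every [a] with [L a < 0] into a
   character [f] with [|f| <= v_L] and [f a <= 0]. So [L] is a positive
   functional on the compact set [K] of characters bounded by [v_L]. A second
   use of the same lemma on maximal cones extends [L] to the bounded functions
   on [K], that is, to a finitely additive measure [nu] on all subsets of [K]; the outer
   measure built from the values of [nu] on compact sets is a Radon measure which
   still represents [L].
   Uniqueness: explicit polynomials converge boundedly to the indicators of
   [{b > 0}], and the finite intersections of these sets form a base of the
   topology of [K]; two representing measures agree on them, hence, by
   regularity, on all Borel sets. *)

(** * Maximal cones *)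

Section total_cone.
Context {R : realType} {V : lmodType R}.
Implicit Types (G : set (V -> V)) (Q : set V) (c e : V).

Definition operator_cone G Q : Prop :=
  (forall x y, Q x -> Q y -> Q (x + y)) /\ (forall g x, G g -> Q x -> Q (g x)).

Definition commuting_operators G : Prop :=
  [/\ forall g, G g -> {morph g : x y / x + y},
      forall g h x, G g -> G h -> g (h x) = h (g x),
      forall g h, G g -> G h -> G (fun x => g x + h x),
      forall g h, G g -> G h -> G (g \o h) &
      forall r : R, 0 <= r -> G ( *:%R r)].

Lemma maximal_cone G Q0 e : operator_cone G Q0 -> ~ Q0 (- e) ->
  exists Q, [/\ operator_cone G Q, Q0 `<=` Q, ~ Q (- e) &
    forall B, operator_cone G B -> Q `<=` B -> ~ B (- e) -> B `<=` Q].
Proof.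
move=> cQ0 nQ0.
(* Adjoining [Q0] inside the predicate makes the union of the empty chain, which is empty, satisfy
   it. *)
pose P Q := operator_cone G (Q0 `|` Q) /\ ~ (Q0 `|` Q) (- e).
have [F FP Ftot|A [[cA nA] Amax]] := @Zorn_bigcup V P.
  split; last by move=> [//|[X FX Xe]]; case: (FP _ FX) => _; apply; right.
  split.
    have key X x y : F X -> (Q0 `|` X) x -> (Q0 `|` X) y ->
        (Q0 `|` \bigcup_(X in F) X) (x + y).
      move=> FX Xx Xy; have [[+ _] _] := FP _ FX => /(_ _ _ Xx Xy).
      by case=> [|Z]; [left | right; exists X].
    move=> x y [Qx|[X FX Xx]] [Qy|[Y FY Yy]].
    - by left; apply: cQ0.1.
    - by apply: (key Y) => //; [left|right].
    - by apply: (key X) => //; [right|left].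
    - have [XY|YX] := Ftot _ _ FX FY.
      + by apply: (key Y) => //; right => //; apply: XY.
      + by apply: (key X) => //; right => //; apply: YX.
  move=> g x Gg [Qx|[X FX Xx]]; first by left; apply: cQ0.2.
  have [[_ +] _] := FP _ FX => /(_ _ _ Gg (or_intror Xx)).
  by case=> [|Z]; [left | right; exists X].
exists (Q0 `|` A); split=> //.
move=> B cB AB nB b Bb; apply: contrapT => nb.
have Q0B : Q0 `|` B = B.
  by rewrite setUidr// => x Q0x; apply: AB; left.
apply: (Amax B); last by split; rewrite Q0B.
split; first by move=> x Ax; apply: AB; right.
by move=> /(_ _ Bb) Ab; apply: nb; right.
Qed.

(** A maximal [Q] works. If neither [c] nor [- c] were in it, maximality would give
    [- e = q + g c = q' - g' c]. Applying [g'] to the first expression and [g] to the second and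
    adding cancels [g (g' c)], which puts [- g e] in [Q]. Since [c] is bounded below by a multiple
    of [e], then [g c] is in [Q], hence so is [- e]. *)
Lemma total_cone_exists G Q0 e : commuting_operators G ->
  operator_cone G Q0 -> Q0 e -> ~ Q0 (- e) ->
  exists Q, [/\ operator_cone G Q, Q0 `<=` Q, ~ Q (- e) &
    forall c, (exists r : R, Q0 (r *: e - c) /\ Q0 (r *: e + c)) ->
      Q c \/ Q (- c)].
Proof.
move=> [Gadd Gcom GD GM GZ] cQ0 Q0e nQ0.
have [Q [[QD QG] Q0Q nQ Qmax]] := maximal_cone cQ0 nQ0.
exists Q; split=> // c [r [Q0c1 Q0c2]].
have Qe := Q0Q _ Q0e.
have QZ s x : 0 <= s -> Q x -> Q (s *: x) by move=> s0; apply: QG; apply: GZ.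
have Gid : G ( *:%R 1) by apply: GZ.
have G0 g : G g -> g 0 = 0.
  by move=> /Gadd gD; apply: (addrI (g 0)); rewrite -gD !addr0.
have GN g x : G g -> g (- x) = - g x.
  move=> Gg; apply: (addrI (g x)); rewrite -(Gadd _ Gg) !subrr; exact: G0.
have Q_0 : Q 0 by rewrite -(scale0r e); apply: QZ.
have ext d : ~ Q d -> exists q g, [/\ Q q, G g & - e = q + g d].
  move=> nd; apply: contrapT => nex.
  (* The cone generated by [Q] and [d]; closure of [G] under sums and composition makes it an
     operator cone. *)
  pose B := [set x | exists q g, [/\ Q q, G g & x = q + g d]].
  apply: nd; apply: (Qmax B); last 1 first.
  - by exists 0, ( *:%R 1); split => //; rewrite scale1r add0r.
  - split=> [x y [q [g [Qq Gg ->]]] [q' [g' [Qq' Gg' ->]]]|h x Gh].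
      exists (q + q'), (fun x => g x + g' x); split; [exact: QD|exact: GD|].
      by rewrite addrACA.
    move=> [q [g [Qq Gg ->]]]; exists (h q), (h \o g).
    by split; [exact: QG|exact: GM|rewrite Gadd].
  - move=> x Qx; exists x, ( *:%R 0); split => //; first exact: GZ.
    by rewrite scale0r addr0.
  - by move=> [q [g [Qq Gg E]]]; apply: nex; exists q, g.
have key d s : Q (s *: e + d) -> 0 <= s -> ~ Q d -> ~ Q (- d) -> False.
  move=> Qsd s0 nd nd'.
  have [q [g [Qq Gg E]]] := ext _ nd.
  have [q' [g' [Qq' Gg' E']]] := ext _ nd'.
  have Qge : Q (- g e).
    have -> : - g e = g' e + (g' q + g q').
      have H1 : - g' e = g' q + g' (g d) by rewrite -(GN g') // E (Gadd g').
      have H2 : - g e = g q' - g' (g d).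
        by rewrite -(GN g) // E' (Gadd g) // (GN g') // (GN g) // (Gcom g).
      have -> : g' q = - g' e - g' (g d) by rewrite H1 addrK.
      have -> : g q' = - g e + g' (g d) by rewrite H2 subrK.
      by rewrite addrA addrA addrA subrr sub0r addrAC addNr add0r.
    have Qg h x : G h -> Q x -> Q (h x) by move=> Gh Qx; apply: QG.
    exact: (QD _ _ (Qg _ _ Gg' Qe) (QD _ _ (Qg _ _ Gg' Qq) (Qg _ _ Gg Qq'))).
  apply: nQ; rewrite E.
  have -> : g d = g (s *: e + d) + s *: - g e.
    by rewrite Gadd// (Gcom g ( *:%R s))//; [rewrite scalerN addrAC subrr add0r|exact: GZ].
  by apply: (QD) => //; apply: QD; [apply: QG|apply: QZ].
apply: contrapT => /not_orP[nc nc'].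
(* For negative [r] the vector [c] is itself in [Q], as the sum of [r *: e + c] and [(- r) *: e]. *)
have [r0|r0] := leP 0 r; first by apply: (key c r) => //; apply: Q0Q.
apply: (key c 0) => //; rewrite scale0r add0r.
have -> : c = (r *: e + c) + (- r) *: e by rewrite scaleNr addrAC subrr add0r.
by apply: QD; [exact: Q0Q|apply: QZ => //; rewrite oppr_ge0 ltW].
Qed.

End total_cone.

(** * Values of vectors relative to a cone *)

Section cone_value.
Context {R : realType} {V : lmodType R} (Q : set V) (e : V).
Hypothesis QD : forall x y, Q x -> Q y -> Q (x + y).
Hypothesis QZ : forall (r : R) x, 0 <= r -> Q x -> Q (r *: x).
Hypothesis nQe : ~ Q (- e).

(** The value at [c] of the state attached to [Q]. It is a relation because a value need exist only
    for vectors bounded by multiples of [e]. *)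
Definition cone_value (c : V) (x : R) : Prop :=
  forall eps : R, 0 < eps ->
    Q (c - (x - eps) *: e) /\ Q ((x + eps) *: e - c).

Lemma cone_value_le c d x y : Q (d - c) -> cone_value c x -> cone_value d y ->
  x <= y.
Proof.
move=> Qdc cx dy; rewrite leNgt; apply/negP => yx; apply: nQe.
(* With a quarter of the gap, the three cone elements add up to [- (2 * t) *: e], a positive
   multiple of [- e]. *)
pose t := (x - y) / 4.
have t0 : 0 < t by rewrite divr_gt0 // ?subr_gt0.
have [+ _] := cx _ t0; have [_ +] := dy _ t0 => Q1 Q2.
have := QD Q1 (QD Qdc Q2).
rewrite !subrKA -scalerBl => Q3.
have -> : - e = (2 * t)^-1 *: ((y + t - (x - t)) *: e).
  rewrite scalerA -scaleN1r; congr (_ *: _).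
  have -> : y + t - (x - t) = - (2 * t).
    have : x = y + 4 * t by rewrite /t mulrC mulfVK // addrC subrK.
    by move=> ->; ring.
  by rewrite mulrN mulVf// gt_eqF// mulr_gt0.
by apply: QZ => //; rewrite invr_ge0 ltW // mulr_gt0.
Qed.

Lemma cone_valueD c d x y : cone_value c x -> cone_value d y ->
  cone_value (c + d) (x + y).
Proof.
move=> cx dy eps e0; have e2 : 0 < eps / 2 by rewrite divr_gt0.
have [c1 c2] := cx _ e2; have [d1 d2] := dy _ e2.
have E : eps = eps / 2 + eps / 2 by rewrite -splitr.
split.
  have := QD c1 d1; rewrite addrACA -opprD -scalerDl.
  by rewrite [X in _ - X *: _]addrACA -opprD -E.
by have := QD c2 d2; rewrite addrACA -opprD -scalerDl [X in X *: _]addrACA -E.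
Qed.

Lemma cone_valueN c x : cone_value c x -> cone_value (- c) (- x).
Proof.
move=> cx eps e0; have [c1 c2] := cx _ e0; split.
  by move: c2; rewrite -[- x - eps]opprD scaleNr opprK addrC.
by rewrite [- x + eps]addrC -[eps - x]opprB scaleNr opprK addrC.
Qed.

Lemma cone_valueZ r c x : cone_value c x -> cone_value (r *: c) (r * x).
Proof.
wlog r0 : r c x / 0 <= r.
  move=> H cx; have [|r0] := leP 0 r; first by move=> r0; apply: H.
  rewrite -[r]opprK scaleNr mulNr; apply: cone_valueN; apply: H => //.
  by rewrite oppr_ge0 ltW.
move=> cx; case: (ltgtP 0 r) r0 => // [r0 _|<- _] eps e0.
  have [c1 c2] := cx _ (divr_gt0 e0 r0); split.
    have := QZ (ltW r0) c1; rewrite scalerBr scalerA mulrBr.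
    by rewrite [r * (_ / _)]mulrC mulfVK // gt_eqF.
  have := QZ (ltW r0) c2; rewrite scalerBr scalerA mulrDr.
  by rewrite [r * (_ / _)]mulrC mulfVK // gt_eqF.
(* For [r = 0] both conditions say that [eps *: e] is in [Q]; the two conditions on [c] add up to
   its double. *)
have [c1 c2] := cx _ e0.
have Qe : Q (eps *: e).
  have := QZ (ler0n R 1) (QD c1 c2).
  rewrite scale1r addrC subrKA -scalerBl.
  have -> : x + eps - (x - eps) = 2 * eps by ring.
  move=> /(QZ (r := 2^-1)); rewrite scalerA mulKf ?invr_ge0 //.
  by apply.
rewrite !scale0r !mul0r !sub0r subr0 add0r scaleNr opprK; split=> //.
Qed.

(** The value is a Dedekind cut, the supremum of the [x] with [c - x *: e] in [Q]. Boundedness makes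
    it finite, and totality gives the condition from above. *)
Lemma cone_value_exists c :
  Q e -> (exists r : R, Q (r *: e - c) /\ Q (r *: e + c)) ->
  (forall x : R, Q (c - x *: e) \/ Q (x *: e - c)) ->
  exists x, cone_value c x.
Proof.
move=> Qe [r [rc1 rc2]] tot.
pose S := [set x | Q (c - x *: e)].
have ubS : ubound S r.
  move=> x Sx; rewrite leNgt; apply/negP => rx; apply: nQe.
  have := QD rc1 Sx; rewrite addrA subrK -scalerBl => /(@QZ (x - r)^-1).
  rewrite invr_ge0 subr_ge0 (ltW rx) => /(_ isT).
  by rewrite scalerA -[r - x]opprB mulrN mulVf ?scaleN1r // subr_eq0 gt_eqF.
have hS : has_sup S.
  split; last by exists r.
  by exists (- r); rewrite /S /= scaleNr opprK addrC.
exists (sup S) => eps e0; split.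
  have [y Sy yS] := sup_adherent e0 hS.
  have -> : c - (sup S - eps) *: e = (c - y *: e) + (y - (sup S - eps)) *: e.
    by rewrite [(y - _) *: e]scalerBl addrA subrK.
  by apply: QD => //; apply: QZ => //; rewrite subr_ge0 ltW.
have [Sx|//] := tot (sup S + eps).
have : sup S + eps <= sup S by apply: ub_le_sup => //; exists r.
by rewrite gerDl leNgt e0.
Qed.

End cone_value.

(** * Weights and characters *)

Lemma charactersP (R : realType) (A : comAlgType R) (f : A -> R) :
  characters A f <-> [/\ f 1 = 1,
    forall r x y, f (r *: x + y) = r * f x + f y &
    forall x y, f (x * y) = f x * f y].
Proof.
split=> [[g _ <-]|[f1 f_lin fM]].
  by split=> *; rewrite ?rmorph1 ?linearP ?rmorphM.
pose l1 := GRing.isLinear.Build R A R *%R f f_lin.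
pose l2 := GRing.isMonoidMorphism.Build A R f (conj f1 fM).
pose F : {lrmorphism A -> R | *%R} := HB.pack f l1 l2.
by exists F.
Qed.

(** After division by [q ^+ n] the right-hand side is a null sequence. *)
Lemma geometric_domination (R : realType) (q t s C : R) : 0 <= t -> t < q ->
  (forall n : nat, q ^+ n * s <= C * t ^+ n) -> s <= 0.
Proof.
move=> t0 tq H; have q0 : 0 < q by apply: le_lt_trans tq.
have {}H n : s <= C * (t / q) ^+ n.
  rewrite expr_div_n mulrA ler_pdivlMr ?exprn_gt0 //.
  by rewrite mulrC; exact: H.
have zlt : `|t / q| < 1.
  by rewrite ger0_norm ?divr_ge0 // ?(ltW q0)// ltr_pdivrMr // mul1r.
have cz : C * (t / q) ^+ n @[n --> \oo] --> C * 0.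
  by apply: cvgM; [exact: cvg_cst | exact: cvg_expr].
rewrite -(mulr0 C) -(cvg_lim _ cz)//; apply: limr_ge; first by apply/cvg_ex; exists (C * 0).
by apply: nearW.
Qed.

Section weights.
Context {R : realType} {A : comAlgType R} (L : {scalar A}).

Definition weight (w : A) : Prop := forall x, 0 <= L (w * x ^+ 2).

Lemma weightM2 w x : weight w -> weight (w * x ^+ 2).
Proof. by move=> Pw y; rewrite -mulrA -exprMn. Qed.

Lemma weight_ge0 w : weight w -> 0 <= L w.
Proof. by move=> /(_ 1); rewrite expr1n mulr1. Qed.

Lemma weight_cauchy_schwarz w x y : weight w ->
  L (w * x * y) ^+ 2 <= L (w * x ^+ 2) * L (w * y ^+ 2).
Proof.
move=> Pw; set a := L (w * x ^+ 2); set b := L _; set c := L (w * y ^+ 2).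
have quad (r : R) : 0 <= a + 2 * r * b + r ^+ 2 * c.
  have := Pw (x + r%:A * y).
  have -> : w * (x + r%:A * y) ^+ 2 = w * x ^+ 2 +
      (r%:A * (w * x * y) + r%:A * (w * x * y)) + r%:A * (r%:A * (w * y ^+ 2)).
    by ring.
  rewrite !mulr_algl !linearD /= !linearZ /= -/a -/b -/c.
  by congr (_ <= _); ring.
have a0 : 0 <= a by apply: Pw.
have c0 : 0 <= c by apply: Pw.
have [c00|cN0] := eqVneq c 0.
  have [->|bN0] := eqVneq b 0; first by rewrite expr0n /= mulr_ge0.
  (* For [c = 0] the polynomial is affine with nonzero slope; at this point it equals [-1]. *)
  have := quad (- (a + 1) / (2 * b)); rewrite c00 mulr0 addr0.
  have -> : a + 2 * (- (a + 1) / (2 * b)) * b = -1 by field.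
  by rewrite oppr_ge0 ler10.
have cp : 0 < c by rewrite lt_def cN0.
(* The minimizer of the quadratic polynomial. *)
have := quad (- b / c).
have -> : a + 2 * (- b / c) * b + (- b / c) ^+ 2 * c = a - b ^+ 2 / c by field.
by rewrite subr_ge0 ler_pdivrMr.
Qed.

(** By log-convexity, [s n = L (w * x ^+ (2 * n))] dominates [q ^+ n * s 0] with [q = s 1 / s 0];
    the growth hypothesis then excludes [q > t]. If [s 0 = 0], log-convexity forces [s 1 = 0]. *)
Lemma weight_square_le w x (t C : R) : weight w -> 0 <= t ->
  (forall n : nat, L (w * x ^+ (2 * n)) <= C * t ^+ n) ->
  L (w * x ^+ 2) <= t * L w.
Proof.
move=> Pw t0 H; pose s n := L (w * x ^+ (2 * n)).
have s_ge0 n : 0 <= s n by rewrite /s mulnC exprM; apply: Pw.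
have sE0 : s 0%N = L w by rewrite /s muln0 expr0 mulr1.
have logc n : s n.+1 ^+ 2 <= s n * s n.+2.
  have -> : s n.+1 = L (w * x ^+ n * x ^+ n.+2).
    by rewrite /s -mulrA -exprD; congr (L (w * x ^+ _)); lia.
  apply: (le_trans (weight_cauchy_schwarz _ _ Pw)).
  by rewrite /s -!exprM (mulnC n) (mulnC n.+2).
have -> : L (w * x ^+ 2) = s 1%N by [].
rewrite -sE0 leNgt; apply/negP => lt1.
have s0p : 0 < s 0%N.
  rewrite lt_def s_ge0 andbT; apply/eqP => s00.
  have := logc 0%N; rewrite s00 mul0r => le0.
  have /eqP : s 1%N ^+ 2 == 0 by rewrite eq_le le0 sqr_ge0.
  by move=> /eqP; rewrite sqrf_eq0 => /eqP s10; move: lt1; rewrite s10 s00 mulr0 ltxx.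
pose q := s 1%N / s 0%N.
have tq : t < q by rewrite ltr_pdivlMr.
have qp : 0 < q by apply: le_lt_trans tq.
have step n : 0 < s n /\ q * s n <= s n.+1.
  elim: n => [|n [sn0 qs]]; first by rewrite divfK // gt_eqF.
  have sn1 : 0 < s n.+1 by apply: lt_le_trans qs; rewrite mulr_gt0.
  split=> //; rewrite -(ler_pM2l sn0); apply: le_trans (logc n).
  by rewrite mulrCA mulrA expr2 ler_wpM2r // ltW.
have pow n : q ^+ n * s 0%N <= s n.
  elim: n => [|n IH]; first by rewrite expr0 mul1r.
  apply: le_trans (step n).2; rewrite exprS -mulrA.
  by rewrite ler_wpM2l // ltW.
have := geometric_domination t0 tq (fun n => le_trans (pow n) (H n)).
by rewrite leNgt s0p.
Qed.

End weights.

(** * The archimedean semiring of multipliers and its characters *)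

Section archimedean_semiring.
Context {R : realType} {A : comAlgType R} (L : {scalar A}) (v : A -> R).
Hypotheses (psdL : psd L) (v_ge0 : forall x, 0 <= v x).
Hypothesis Lv : forall x n, L (x ^+ (2 * n)) <= v x ^+ (2 * n).

Let weight1 : weight L 1. Proof. by move=> x; rewrite mul1r. Qed.

(** Cauchy-Schwarz for the weight 1 bounds [L (w * x ^+ (2 * n))] by the square root of [L (w ^+ 2)]
    times [v x ^+ (2 * n)], so the growth criterion controls [L (w * x ^+ 2)]. Cauchy-Schwarz for
    [w], applied to 1 and [x], concludes. *)
Lemma weight_mul_bound w x : weight L w -> `|L (w * x)| <= v x * L w.
Proof.
move=> Pw; have Lw0 := weight_ge0 Pw.
have x2 : L (w * x ^+ 2) <= v x ^+ 2 * L w.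
  apply: (weight_square_le (C := Num.sqrt (L (w ^+ 2)))) => //; first exact: sqr_ge0.
  move=> n.
  have := weight_cauchy_schwarz w (x ^+ (2 * n)) weight1.
  rewrite !mul1r -exprM => H.
  have {}H : L (w * x ^+ (2 * n)) ^+ 2 <=
      (Num.sqrt (L (w ^+ 2)) * (v x ^+ 2) ^+ n) ^+ 2.
    apply: (le_trans H); rewrite exprMn sqr_sqrtr; last exact: psdL.
    by rewrite ler_wpM2l ?psdL // -!exprM -mulnA; exact: Lv.
  rewrite -ler_sqr ?nnegrE //; first by rewrite mulnC exprM; apply: Pw.
  by rewrite mulr_ge0 ?sqrtr_ge0 ?exprn_ge0 // sqr_ge0.
rewrite -(@ler_pXn2r _ 2) ?nnegrE ?mulr_ge0 // real_normK ?num_real //.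
have := weight_cauchy_schwarz 1 x Pw; rewrite mulr1 expr1n mulr1 => /le_trans; apply.
have -> : (v x * L w) ^+ 2 = L w * (v x ^+ 2 * L w) by ring.
by rewrite ler_wpM2l.
Qed.

(** Closure under products is immediate for multipliers but not for weights. *)
Definition weight_multiplier : set A :=
  [set t | forall w, weight L w -> weight L (t * w)].
Local Notation T := weight_multiplier.

Lemma weight_multiplierD s t : T s -> T t -> T (s + t).
Proof.
by move=> Ts Tt w Pw x; rewrite 2!mulrDl linearD /= addr_ge0 // ?(Ts _ Pw) ?(Tt _ Pw).
Qed.

Lemma weight_multiplierM s t : T s -> T t -> T (s * t).
Proof. by move=> Ts Tt w Pw; rewrite -mulrA; apply/Ts/Tt. Qed.

Lemma weight_multiplier_scale (r : R) : 0 <= r -> T r%:A.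
Proof.
move=> r0 w Pw x; rewrite mulr_algl -scalerAl linearZ /=.
by rewrite mulr_ge0 //; apply: Pw.
Qed.

Lemma weight_multiplier_arch x : T ((v x)%:A - x) /\ T ((v x)%:A + x).
Proof.
split=> w Pw y.
  have := weight_mul_bound x (weightM2 y Pw); rewrite ler_norml => /andP[_ H].
  have -> : ((v x)%:A - x) * w * y ^+ 2 =
      (v x)%:A * (w * y ^+ 2) - w * y ^+ 2 * x by ring.
  by rewrite linearB /= mulr_algl linearZ subr_ge0.
have := weight_mul_bound x (weightM2 y Pw); rewrite ler_norml => /andP[H _].
have -> : ((v x)%:A + x) * w * y ^+ 2 =
    (v x)%:A * (w * y ^+ 2) + w * y ^+ 2 * x by ring.
by rewrite linearD /= mulr_algl linearZ -lerBlDl sub0r.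
Qed.

Lemma weight_multiplier_ge0 t : T t -> 0 <= L t.
Proof. by move=> /(_ _ weight1)/weight_ge0; rewrite mulr1. Qed.

(* If [a * s = 1 + t] and [0 <= s <= k], then [(k - s)(a + r) >= 0] reads
   [k (a + r) >= 1 + t + s r], so the constant [r] in [a + r >= 0] can be
   lowered by [1/k] as long as it is nonnegative. *)
Lemma weight_multiplier_quotient a s t :
  T s -> T t -> a * s = 1 + t -> T a.
Proof.
move=> Ts Tt as1.
have [_ vaT] := weight_multiplier_arch a.
pose k := v s + 1.
have k0 : 0 < k by rewrite ltr_wpDl.
have Tks : T (k%:A - s).
  have -> : k%:A - s = ((v s)%:A - s) + 1%:A by rewrite /k scalerDl addrAC.
  apply: weight_multiplierD; first exact: (weight_multiplier_arch s).1.
  exact: weight_multiplier_scale.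
have step r : 0 <= r -> T (a + r%:A) -> T (a + (r - k^-1)%:A).
  move=> r0 Tar.
  have -> : a + (r - k^-1)%:A =
      (k^-1)%:A * ((k%:A - s) * (a + r%:A) + (t + r%:A * s)).
    have -> : (k%:A - s) * (a + r%:A) + (t + r%:A * s) =
        k%:A * (a + r%:A) - 1 by rewrite -[t](addKr 1) -as1; ring.
    rewrite !mulr_algl scalerBr scalerA mulVf ?gt_eqF // scale1r.
    by rewrite scalerBl addrA.
  apply: weight_multiplierM; first by apply: weight_multiplier_scale; rewrite invr_ge0 ltW.
  apply: weight_multiplierD; first exact: weight_multiplierM.
  apply: weight_multiplierD => //.
  by apply: weight_multiplierM => //; exact: weight_multiplier_scale.
have up r r' : r <= r' -> T (a + r%:A) -> T (a + r'%:A).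
  move=> rr' Tr; have -> : a + r'%:A = a + r%:A + (r' - r)%:A.
    by rewrite -addrA -scalerDl subrKC.
  by apply: weight_multiplierD => //; apply: weight_multiplier_scale; rewrite subr_ge0.
(* Iteration of [step] from the initial constant [v a]; truncation at 0 keeps [step] applicable. *)
have low n : T (a + (Num.max 0 (v a - n%:R * k^-1))%:A).
  elim: n => [|n IH].
    by apply: (up (v a)); [rewrite mul0r subr0 le_max lexx orbT|rewrite addrC].
  apply: (up _ _ _ (step _ _ IH)); last by rewrite le_max lexx.
  rewrite [in leLHS]maxEle; case: ifP => _.
    by rewrite le_max -addrA -opprD -[X in _ - (_ + X)]mul1r -mulrDl natr1 lexx orbT.
  by rewrite le_max sub0r oppr_le0 invr_ge0 ltW.
have [n hn] : exists n, v a - n%:R * k^-1 <= 0.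
  exists (Num.truncn (v a * k)).+1; rewrite subr_le0 ler_pdivlMr // ltW //.
  exact: truncnS_gt.
by have := low n; rewrite (max_idPl hn) scale0r addr0.
Qed.

(** Since [L a < 0], [a] is not a multiplier, so by the quotient lemma [-1] is not in the module
    [T - a T]. A maximal module containing it and avoiding [-1] is total, because the semiring is
    archimedean, and [f] is the associated value. Elements of the module have nonnegative value;
    applied to [- a] this gives [f a <= 0], applied to [v x - x] and [v x + x] it gives the
    bound. *)
Lemma character_with_nonpos_value a : L a < 0 ->
  exists f : A -> R, [/\ characters A f, forall x, `|f x| <= v x & f a <= 0].
Proof.
move=> La0.
have Ta : ~ T a by move=> /weight_multiplier_ge0; rewrite leNgt La0.
have T1 : T 1 by rewrite -(scale1r 1); exact: weight_multiplier_scale.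
have T0 : T 0 by rewrite -(scale0r 1); exact: weight_multiplier_scale.
pose G := [set g : A -> A | exists2 t, T t & g = *%R t].
have GG : commuting_operators G.
  split.
  - by move=> _ [t _ ->] x y; rewrite mulrDr.
  - by move=> _ _ x [s _ ->] [t _ ->]; rewrite mulrCA.
  - move=> _ _ [s Ts ->] [t Tt ->]; exists (s + t); first exact: weight_multiplierD.
    by apply/funext => x; rewrite mulrDl.
  - move=> _ _ [s Ts ->] [t Tt ->]; exists (s * t); first exact: weight_multiplierM.
    by apply/funext => x /=; rewrite mulrA.
  - move=> r r0; exists r%:A; first exact: weight_multiplier_scale.
    by apply/funext => x; rewrite mulr_algl.
(* The module generated by 1 and [- a] over the semiring of multipliers. *)
pose Q0 := [set x | exists s t, [/\ T s, T t & x = t - a * s]].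
have TQ0 t : T t -> Q0 t by move=> Tt; exists 0, t; rewrite mulr0 subr0.
have cQ0 : operator_cone G Q0.
  split=> [x y [s [t [Ts Tt ->]]] [s' [t' [Ts' Tt' ->]]]|g x [u Tu ->] [s [t [Ts Tt ->]]]].
    exists (s + s'), (t + t'); split; try exact: weight_multiplierD.
    by ring.
  exists (u * s), (u * t); split; try exact: weight_multiplierM.
  by ring.
have nQ0 : ~ Q0 (- 1).
  move=> [s [t [Ts Tt E]]]; apply: Ta; apply: (weight_multiplier_quotient Ts Tt).
  by rewrite -[t](subrK (a * s)) -E addrA subrr add0r.
have [Q [[QD QG] Q0Q nQ tot]] := total_cone_exists GG cQ0 (TQ0 _ T1) nQ0.
have QZ (r : R) x : 0 <= r -> Q x -> Q (r *: x).
  by move=> r0 Qx; apply: QG => //; case: GG => _ _ _ _; apply.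
have TQ t x : T t -> Q x -> Q (t * x) by move=> Tt Qx; apply: QG => //; exists t.
have bounded x : exists r : R, Q0 (r%:A - x) /\ Q0 (r%:A + x).
  by have [? ?] := weight_multiplier_arch x; exists (v x); split; apply: TQ0.
have total x : Q x \/ Q (- x) by exact: tot.
have Qsub t : T t -> Q t by move=> /TQ0/Q0Q.
have ex x : exists y, cone_value Q 1 x y.
  apply: cone_value_exists => //; first exact: Qsub.
    by have [r [? ?]] := bounded x; exists r; split; apply: Q0Q.
  by move=> y; have [|] := total (x - y%:A); [left|right; rewrite -opprB].
pose f x := sval (cid (ex x)).
have fP x : cone_value Q 1 x (f x) by rewrite /f; case: cid.
have Q_0 : Q 0 by exact: Qsub.
have uniq x y z : cone_value Q 1 x y -> cone_value Q 1 x z -> y = z.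
  move=> xy xz; apply/eqP; rewrite eq_le.
  by rewrite !(cone_value_le QD QZ nQ (c := x) (d := x))// subrr.
have fD x y : f (x + y) = f x + f y by apply: uniq (fP _) _; exact: cone_valueD.
have fZ r x : f (r *: x) = r * f x by apply: uniq (fP _) _; exact: cone_valueZ.
have f1 : f 1 = 1.
  apply: uniq (fP _) _ => eps e0.
  have -> : 1 - (1 - eps)%:A = eps *: (1 : A) by rewrite scalerBl scale1r subKr.
  have -> : (1 + eps)%:A - 1 = eps *: (1 : A) by rewrite scalerDl scale1r addrC addKr.
  by split; apply: QZ (ltW e0) (Qsub _ T1).
have f0 : f 0 = 0 by rewrite -(scale0r 0) fZ mul0r.
have fN x : f (- x) = - f x by rewrite -scaleN1r fZ mulN1r.
have f_ge0 x : Q x -> 0 <= f x.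
  by move=> Qx; rewrite -f0; apply: (cone_value_le QD QZ nQ _ (fP 0) (fP x)); rewrite subr0.
have fv x : `|f x| <= v x.
  have [/Qsub/f_ge0 + /Qsub/f_ge0] := weight_multiplier_arch x.
  rewrite !fD fZ f1 fN mulr1 subr_ge0 ler_norml => -> /=.
  by rewrite addrC -lerBlDr sub0r => ->.
(* In the order of [Q], [x] lies between [- d] and [d], so [t * x] lies between [- d *: t] and
   [d *: t]. The choice of [d] gives [d *: t <= eps], since [t <= v t]; the added 1 keeps the
   denominator positive. *)
have ker t x : T t -> f x = 0 -> f (t * x) = 0.
  move=> Tt fx0; apply: uniq (fP _) _ => eps e0.
  have ft0 := f_ge0 _ (Qsub _ Tt).
  have d0 : 0 < eps / (v t + 1) by rewrite divr_gt0 // ltr_wpDl.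
  have [x1 x2] := fP x _ d0; move: x1 x2; rewrite fx0 sub0r add0r.
  set d := eps / _ in d0 * => x1 x2.
  have Tdt : Q (eps%:A - d *: t).
    have -> : eps%:A - d *: t = d *: (((v t)%:A - t) + 1).
      have -> : eps = d * v t + d.
        by rewrite -[X in _ + X]mulr1 -mulrDr /d mulfVK // gt_eqF // ltr_wpDl.
      by rewrite scalerDr scalerBr scalerA scalerDl addrAC.
    apply: QZ (ltW d0) _; apply: (QD) => //; last exact: Qsub.
    exact/Qsub/(weight_multiplier_arch t).1.
  rewrite sub0r add0r scaleNr opprK; split.
    have -> : t * x + eps%:A = (eps%:A - d *: t) + t * (x - (- d)%:A).
      by rewrite scaleNr opprK mulrDr mulr_algr [t * x + d *: t]addrC addrA subrK addrC.
    by apply: (QD) => //; apply: TQ.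
  have -> : eps%:A - t * x = (eps%:A - d *: t) + t * (d%:A - x).
    by rewrite mulrBr mulr_algr addrA subrK.
  by apply: (QD) => //; apply: TQ.
(* Every [z] is the multiplier [(v z)%:A + z] minus a constant, so the kernel of [f] is an ideal; it
   contains [y - (f y)%:A]. *)
have fM x y : f (x * y) = f x * f y.
  have kerA z u : f u = 0 -> f (z * u) = 0.
    move=> fu; have [_ Tz] := weight_multiplier_arch z.
    have : f (((v z)%:A + z) * u) = 0 by exact: ker.
    by rewrite mulrDl fD mulr_algl fZ fu mulr0 add0r.
  have : f (x * (y - (f y)%:A)) = 0 by apply: kerA; rewrite fD fN fZ f1 mulr1 subrr.
  rewrite mulrBr fD fN mulr_algr fZ => /eqP.
  by rewrite subr_eq0 [f y * _]mulrC => /eqP.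
exists f; split=> //.
  by apply/charactersP; split=> // r x y; rewrite fD fZ.
have : Q0 (- a) by exists 1, 0; rewrite mulr1 sub0r.
by move=> /Q0Q/f_ge0; rewrite fN oppr_ge0.
Qed.

End archimedean_semiring.

(** * From finitely additive set functions to Radon measures *)

Section compact_separation.
Context {T : topologicalType}.
Hypothesis hT : hausdorff_space T.

(** Otherwise the sets [A] intersected with [closure E] generate a proper filter on the compact set
    [A]. A cluster point of it lies in every [closure E], against the hypothesis. *)
Lemma compact_avoid_closure (G : set_system T) (A : set T) : Filter G ->
  compact A -> (forall y, A y -> exists2 E, G E & ~ closure E y) ->
  exists2 E, G E & A `&` closure E = set0.
Proof.
move=> FG cA H; apply: contrapT => nE.
have ne E : G E -> (A `&` closure E) !=set0.
  by move=> GE; apply/set0P/eqP => AE; apply: nE; exists E.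
pose F := filter_from G (fun E => A `&` closure E).
have PF : ProperFilter F.
  apply: filter_from_proper => //; apply: filter_from_filter.
    by exists setT; exact: filterT.
  move=> E1 E2 GE1 GE2; exists (E1 `&` E2); first exact: filterI.
  move=> x [Ax cx]; split; split=> //; apply: closure_subset cx => y [] //.
have FA : F A by exists setT => [|x [] //]; exact: filterT.
have [y [Ay cy]] := cA F PF FA.
have [E GE nEy] := H _ Ay; apply: nEy.
have clE := @closed_closure _ E; apply: clE => N Ny.
have [z [[_ zE] Nz]] := cy _ _ (ex_intro2 _ _ E GE (fun z => id)) Ny.
by exists z.
Qed.

(** The parts of [C] outside [U] and outside [V] are disjoint compact sets. Removing from [C] an
    open neighbourhood of the first gives [C1]; intersecting [C] with a closed neighbourhood of the
    first that misses the second gives [C2]. *)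
Lemma compact_split (C U V : set T) : compact C -> open U -> open V ->
  C `<=` U `|` V -> exists C1 C2, [/\ compact C1, compact C2,
    C1 `<=` U, C2 `<=` V & C = C1 `|` C2].
Proof.
move=> cC oU oV CUV.
have compD W : open W -> compact (C `\` W).
  by move=> oW; rewrite setDE; apply: compact_closedI => //; apply: open_closedC.
(* Hausdorff separation in two rounds: first a point from a compact set, then the two compact sets
   from each other. *)
have [W BW AW] : exists2 W, set_nbhs (C `\` U) W & (C `\` V) `&` closure W = set0.
  apply: compact_avoid_closure; first exact: compD.
  move=> y [Cy nVy].
  have [N Ny BN] : exists2 N, nbhs y N & (C `\` U) `&` closure N = set0.
    apply: compact_avoid_closure; first exact: compD.
    move=> z [Cz nUz]; apply: contrapT => nE.
    have yz : y = z.
      apply: hT; rewrite clusterE => E /= NE.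
      by apply: contrapT => nEz; apply: nE; exists E.
    by have [Uy|//] := CUV _ Cy; apply: nUz; rewrite -yz.
  exists (~` closure N).
    apply/set_nbhsP; exists (~` closure N); split=> //.
      by apply: closed_openC; exact: closed_closure.
    by move=> z Bz Nz; have : ((C `\` U) `&` closure N) z by []; rewrite BN.
  move=> /(_ _ Ny)[z [nNz Nz]]; apply: nNz; exact: subset_closure.
have [W' [oW' BW' W'W]] := (set_nbhsP _ _).1 BW.
exists (C `\` W'), (C `&` closure W); split.
- exact: compD.
- by apply: compact_closedI => //; exact: closed_closure.
- by move=> x [Cx nWx]; apply: contrapT => nUx; apply: nWx; apply: BW'.
- move=> x [Cx Wx]; apply: contrapT => nVx.
  by have : ((C `\` V) `&` closure W) x by []; rewrite AW.
- apply/seteqP; split=> x; last by move=> [[]|[]].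
  move=> Cx; have [Wx|Wx] := pselect (W' x); last by left.
  by right; split=> //; apply/subset_closure/W'W.
Qed.

Lemma compact_split_bigcup (C : set T) (U : nat -> set T) (n : nat) :
  compact C -> (forall i, open (U i)) -> C `<=` \big[setU/set0]_(i < n) U i ->
  exists D : nat -> set T, [/\ forall i, compact (D i), forall i, D i `<=` U i &
    C = \big[setU/set0]_(i < n) D i].
Proof.
elim: n C => [|n IH] C cC oU.
  rewrite big_ord0 => C0; exists (fun=> set0); split.
  - by move=> i; exact: compact0.
  - by move=> i x.
  - by rewrite big_ord0; apply/seteqP; split.
rewrite big_ord_recr /= => CU.
have oB : open (\big[setU/set0]_(i < n) U i).
  by rewrite -bigcup_mkord; apply: bigcup_open.
have [C1 [C2 [cC1 cC2 C1U C2U E]]] := compact_split cC oB (oU n) CU.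
have [D [cD DU C1D]] := IH _ cC1 oU C1U.
exists (fun i => if i == n then C2 else D i); split.
- by move=> i; case: ifP.
- by move=> i; case: eqP => [->|].
- rewrite big_ord_recr /= eqxx E C1D; congr (_ `|` _).
  by apply: eq_bigr => i _; rewrite ltn_eqF.
Qed.

End compact_separation.

Lemma compact_bigcup_finite {T : ptopologicalType} (C : set T) (U : nat -> set T) :
  compact C -> (forall i, open (U i)) -> C `<=` \bigcup_i U i ->
  exists n, C `<=` \big[setU/set0]_(i < n) U i.
Proof.
move=> + oU CU; rewrite compact_cover => /(_ nat setT U (fun i _ => oU i) CU)[D' _ CD].
exists (\max_(i <- enum_fset D') i).+1; rewrite -bigcup_mkord => x /CD[i /= iD Uix].
exists i => //=; rewrite ltnS.
by apply: (@leq_bigmax_seq _ _ xpredT id).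
Qed.

Section finitely_additive.
Context {R : realType} {T : Type} (nu : set T -> R).
Hypothesis nu_ge0 : forall E, 0 <= nu E.
Hypothesis nuU : forall E F, E `&` F = set0 -> nu (E `|` F) = nu E + nu F.

Lemma fin_additive0 : nu set0 = 0.
Proof. by apply: (addrI (nu set0)); rewrite -nuU ?setI0// setU0 addr0. Qed.

Lemma fin_additive_le E F : E `<=` F -> nu E <= nu F.
Proof.
move=> EF; have -> : F = E `|` (F `\` E) by rewrite setDUK.
by rewrite nuU ?lerDl// setDE setICA setICr setI0.
Qed.

Lemma fin_additive_subadditive E F : nu (E `|` F) <= nu E + nu F.
Proof.
have -> : E `|` F = E `|` (F `\` E) by rewrite setUDr setDv setD0.
rewrite nuU ?lerD2l; first by apply: fin_additive_le; exact: subDsetl.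
by rewrite setDE setICA setICr setI0.
Qed.

End finitely_additive.

Lemma borel_open {T : ptopologicalType} (U : set T) :
  open U -> measurable (U : set (borel T)).
Proof. by move=> oU; exact: sub_sigma_algebra. Qed.

Lemma borel_closed {T : ptopologicalType} (C : set T) :
  closed C -> measurable (C : set (borel T)).
Proof.
move=> cC; rewrite -[C]setCK; apply: measurableC; apply: borel_open.
exact: closed_openC.
Qed.

(** * The Radon measure induced by a finitely additive set function *)

Section content_measure.
Context {R : realType} {T : ptopologicalType} (nu : set T -> R) (K : set T).
Hypothesis hT : hausdorff_space T.
Hypothesis cK : compact K.
Hypothesis nu_ge0 : forall E, 0 <= nu E.
Hypothesis nuU : forall E F, E `&` F = set0 -> nu (E `|` F) = nu E + nu F.
Hypothesis nuK : nu (~` K) = 0.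

Local Open Scope ereal_scope.

(** Since [nu] is only finitely additive, open sets are measured through their compact subsets, so
    that finite subcovers can yield countable subadditivity. *)
Definition inner_content (U : set T) : \bar R :=
  ereal_sup [set (nu C)%:E | C in [set C | compact C /\ C `<=` U]].
Local Notation m := inner_content.

Definition content_outer (E : set T) : \bar R :=
  ereal_inf [set m U | U in [set U | open U /\ E `<=` U]].
Local Notation mo := content_outer.

Let nu_le := fin_additive_le nu_ge0 nuU.
Let nu0 := fin_additive0 nuU.

Lemma inner_content_le U V : U `<=` V -> m U <= m V.
Proof.
move=> UV; apply: ge_ereal_sup => _ [C [cC CU] <-].
by apply: ereal_sup_ubound; exists C => //; split=> //; exact: subset_trans UV.
Qed.

Lemma inner_content_ub C U : compact C -> C `<=` U -> (nu C)%:E <= m U.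
Proof. by move=> cC CU; apply: ereal_sup_ubound; exists C. Qed.

Lemma inner_content_ge0 U : 0 <= m U.
Proof. by rewrite -[0]/(0%R%:E) -nu0; apply: inner_content_ub; [exact: compact0|]. Qed.

Lemma inner_content_nu U : m U <= (nu U)%:E.
Proof. by apply: ge_ereal_sup => _ [C [cC CU] <-]; rewrite lee_fin nu_le. Qed.

Lemma inner_contentT : m setT = (nu setT)%:E.
Proof.
apply/eqP; rewrite eq_le inner_content_nu /=.
have -> : nu setT = nu K.
  by rewrite -(setUv K) nuU ?setICr// nuK addr0.
exact: inner_content_ub.
Qed.

Lemma content_outer_le E F : E `<=` F -> mo E <= mo F.
Proof.
move=> EF; apply: le_ereal_inf_tmp => _ [U [oU FU] <-].
by apply: ereal_inf_lbound; exists U => //; split=> //; exact: subset_trans FU.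
Qed.

Lemma content_outer_open U : open U -> mo U = m U.
Proof.
move=> oU; apply/eqP; rewrite eq_le; apply/andP; split.
  by apply: ereal_inf_lbound; exists U => //; split.
by apply: le_ereal_inf_tmp => _ [V [oV UV] <-]; exact: inner_content_le.
Qed.

Lemma content_outer_ge0 E : 0 <= mo E.
Proof.
by apply: le_ereal_inf_tmp => _ [U _ <-]; exact: inner_content_ge0.
Qed.

Lemma content_outer_fin E : mo E \is a fin_num.
Proof.
rewrite ge0_fin_numE ?content_outer_ge0//.
apply: le_lt_trans (content_outer_le (@subsetT _ E)) _.
by rewrite content_outer_open ?inner_contentT ?ltry//; exact: openT.
Qed.

Lemma content_outer0 : mo set0 = 0.
Proof.
rewrite content_outer_open; last exact: open0.
apply/eqP; rewrite eq_le inner_content_ge0 andbT.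
by apply: le_trans (inner_content_nu _) _; rewrite nu0.
Qed.

(** A compact [C] inside the union is covered by finitely many [U i] and splits into compact pieces,
    each inside one of them; finite subadditivity of [nu] then suffices. *)
Lemma inner_content_sigma_subadditive (U : nat -> set T) :
  (forall i, open (U i)) -> m (\bigcup_i U i) <= \sum_(i <oo) m (U i).
Proof.
move=> oU; apply: ge_ereal_sup => _ [C [cC CU] <-].
have [n Cn] := compact_bigcup_finite cC oU CU.
have [D [cD DU ->]] := compact_split_bigcup hT cC oU Cn.
apply: (@le_trans _ _ (\sum_(0 <= i < n) m (U i))); last first.
  by apply: nneseries_lim_ge => i _ _; exact: inner_content_ge0.
rewrite big_mkord; elim: n {Cn} => [|n IH].
  by rewrite !big_ord0 nu0.
rewrite !big_ord_recr /=.
apply: (@le_trans _ _ ((nu (\big[setU/set0]_(i < n) D i))%:E + (nu (D n))%:E)).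
  by rewrite -EFinD lee_fin fin_additive_subadditive.
by apply: leeD => //; exact: inner_content_ub.
Qed.

Lemma content_outer_sigma_subadditive : sigma_subadditive mo.
Proof.
move=> F; apply/lee_addgt0Pr => e e0.
apply: (@le_trans _ _ (\sum_(i <oo) (mo (F i) + (e / (2 ^ i.+1)%:R)%:E))); last first.
  by apply: epsilon_trick => //; [move=> n; exact: content_outer_ge0|exact: ltW].
have /choice[U HU] : forall i, exists U, [/\ open U, F i `<=` U &
    m U <= mo (F i) + (e / (2 ^ i.+1)%:R)%:E].
  move=> i; have d0 : (0 < e / (2 ^ i.+1)%:R :> R)%R.
    by rewrite divr_gt0 // ltr0n expn_gt0.
  have [_ [U [oU FU] <-] mU] := lb_ereal_inf_adherent d0 (content_outer_fin (F i)).
  by exists U; split=> //; exact: ltW.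
apply: (@le_trans _ _ (\sum_(i <oo) m (U i))); last first.
  apply: lee_nneseries => i *; first exact: inner_content_ge0.
  by have [] := HU i.
have oU i : open (U i) by have [] := HU i.
apply: le_trans (inner_content_sigma_subadditive oU).
apply: ereal_inf_lbound; exists (\bigcup_i U i) => //; split.
  exact: bigcup_open.
by apply: subset_bigcup => i _; have [] := HU i.
Qed.

HB.instance Definition _ := isOuterMeasure.Build R T mo content_outer0
  content_outer_ge0 content_outer_le content_outer_sigma_subadditive.

(** For [V] open around [X], take [C] compact in the intersection of [V] and [U], then [D] compact
    in the open set [V] minus [C], which contains [V] minus [U]. Both lie in [V] and are disjoint,
    so [nu C + nu D <= m V]; take suprema over [D], then over [C]. *)
Lemma open_caratheodory U : open U -> mo.-caratheodory U.
Proof.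
move=> oU; apply: le_caratheodory_measurable => X.
apply: le_ereal_inf_tmp => _ [V [oV XV] <-].
apply: (@le_trans _ _ (mo (V `&` U) + mo (V `&` ~` U))).
  by apply: leeD; apply: content_outer_le; exact: setSI.
rewrite content_outer_open; last exact: openI.
rewrite -leeBrDr ?content_outer_fin//; apply: ge_ereal_sup => _ [C [cC CVU] <-].
rewrite leeBrDr ?content_outer_fin// addeC -leeBrDr //.
have oVC : open (V `\` C).
  by rewrite setDE; apply: openI => //; apply: closed_openC; exact: compact_closed.
apply: (@le_trans _ _ (m (V `\` C))).
  rewrite -content_outer_open//; apply: content_outer_le.
  by move=> x [Vx nUx]; split=> // /CVU[].
apply: ge_ereal_sup => _ [D [cD DVC] <-].
rewrite leeBrDr // -EFinD -nuU; last first.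
  by apply/seteqP; split=> // x [/DVC[]].
apply: inner_content_ub; first exact: compactU.
by move=> x [/DVC[]|/CVU[]].
Qed.

Lemma borel_caratheodory (B : set (borel T)) : measurable B -> mo.-caratheodory B.
Proof.
apply: smallest_sub; last exact: open_caratheodory.
exact: (@sigma_algebra_measurable _ (caratheodory_type mo)).
Qed.

(** The measure is the outer measure on Borel sets, outer regular by construction. As all mass is on
    the compact set [K], outer regularity at the complement of a Borel set becomes inner regularity
    at the set itself. *)
Lemma content_measure : exists mu : {measure set (borel T) -> \bar R},
  [/\ radon_on K mu, mu setT = (nu setT)%:E &
      forall U : set T, open U -> mu U <= (nu U)%:E].
Proof.
have sadd : semi_sigma_additive (mo : set (borel T) -> \bar R).
  move=> F mF tF mUF.
  apply: (@caratheodory_measure_sigma_additive R T mo) => // [i|]; exact: borel_caratheodory.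
pose mixin := isMeasure.Build _ (borel T) R (mo : set (borel T) -> \bar R)
  content_outer0 content_outer_ge0 sadd.
pose mu : {measure set (borel T) -> \bar R} := HB.pack (mo : set (borel T) -> \bar R) mixin.
have muE E : mu E = mo E by [].
have clK : closed K by exact: compact_closed.
have muT : mu setT = (nu setT)%:E.
  by rewrite muE content_outer_open ?inner_contentT//; exact: openT.
have muK0 : mu (~` K) = 0.
  rewrite muE content_outer_open; last exact: closed_openC.
  apply/eqP; rewrite eq_le inner_content_ge0 andbT.
  by rewrite (le_trans (inner_content_nu _))// nuK.
exists mu; split=> //; last first.
  by move=> U oU; rewrite muE content_outer_open//; exact: inner_content_nu.
have mu_fin E : mu E \is a fin_num by exact: content_outer_fin.
split=> //; split=> [C cC|B mB].
  by rewrite -ge0_fin_numE ?measure_ge0.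
apply/eqP; rewrite eq_le; apply/andP; split; last first.
  by apply: ge_ereal_sup => _ [C [cC CB] <-]; exact: content_outer_le.
apply/lee_addgt0Pr => e e0.
(* An open [U] around the complement of [B], of nearly the same measure; the part of [K] outside [U]
   is then compact, inside [B], and misses at most [e] of its measure. *)
have [_ [U [oU BU] <-] mU] := lb_ereal_inf_adherent e0 (content_outer_fin (~` B)).
have cKU : compact (K `&` ~` U) by apply: compact_closedI => //; exact: open_closedC.
have mKU : measurable (K `&` ~` U : set (borel T)) by apply: borel_closed; exact: compact_closed.
apply: (@le_trans _ _ (mu (K `&` ~` U) + e%:E)); last first.
  apply: leeD => //; apply: ereal_sup_ubound; exists (K `&` ~` U) => //; split=> //.
  by move=> x [_ nUx]; apply: contrapT => /BU.
have muB : mu B + mu (~` B) = mu setT.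
  by rewrite -measureU ?setUv ?setICr//; exact: measurableC.
have tot : mu setT <= mu (K `&` ~` U) + mu U.
  apply: (@le_trans _ _ (mu ((K `&` ~` U) `|` ~` K `|` U))).
    apply: content_outer_le => x _.
    have [Ux|nUx] := pselect (U x); first by right.
    by left; have [Kx|nKx] := pselect (K x); [left|right].
  apply: le_trans (measureU2 _ _ _) _.
  - by apply: measurableU => //; apply: borel_open; exact: closed_openC.
  - exact: borel_open.
  apply: leeD => //; apply: le_trans (measureU2 _ _ _) _ => //.
    by apply: borel_open; exact: closed_openC.
  rewrite -[leRHS]adde0; apply: leeD => //.
  by rewrite le_eqVlt; apply/orP; left; apply/eqP; exact: muK0.
rewrite -(leeD2rE _ _ (mu_fin (~` B))) muB (le_trans tot)// -addeA leeD2lE//.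
by rewrite addeC -(content_outer_open oU) in mU *; rewrite muE; exact: ltW.
Qed.

End content_measure.

(** * Representation of positive functionals *)

Section borel_facts.
Context {R : realType} {T : ptopologicalType}.

Lemma continuous_borel_measurable (D : set (borel T)) (f : T -> R) :
  continuous f -> measurable_fun D (f : borel T -> R).
Proof.
move=> cf; apply: measurable_funTS.
move=> mD; apply: (measurability _ (RGenOInfty.measurableE R)) => //.
move=> _ [_ [x ->] <-].
rewrite setTI; apply: borel_open; by apply: open_comp.
Qed.

Lemma compact_bound (K : set T) (f : T -> R) : compact K -> continuous f ->
  exists2 M : R, 0 < M & forall x, K x -> `|f x| <= M.
Proof.
move=> cK cf.
have : compact (f @` K).
  by apply: continuous_compact => //; exact: continuous_subspaceT.
move=> /compact_bounded[M [_ HM]].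
exists (Num.max 1 (M + 1)); first by rewrite lt_max ltr01.
move=> x Kx; apply: (HM (Num.max 1 (M + 1))); last by exists x.
by rewrite lt_max ltrDl ltr01 orbT.
Qed.

Lemma continuous_integrable_on_compact (mu : {measure set (borel T) -> \bar R})
    (K : set T) (f : T -> R) : hausdorff_space T -> compact K ->
  (mu K < +oo)%E -> continuous f -> mu.-integrable K (EFin \o f).
Proof.
move=> hT cK Kfin cf; apply: measurable_bounded_integrable => //.
- by apply: borel_closed; exact: compact_closed.
- exact: continuous_borel_measurable.
have [M M0 HM] := compact_bound cK cf.
exists M; split; first by rewrite num_real.
by move=> x Mx y Ky; apply: le_trans (HM _ Ky) _; exact: ltW.
Qed.

End borel_facts.

Section characters_theory.
Context {R : realType} {B : comAlgType R} (f : B -> R).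
Hypothesis cf : characters B f.

Lemma character1 : f 1 = 1.
Proof. by case: cf => g _ <-; rewrite rmorph1. Qed.
Lemma characterD a b : f (a + b) = f a + f b.
Proof. by case: cf => g _ <-; rewrite linearD. Qed.
Lemma characterN a : f (- a) = - f a.
Proof. by case: cf => g _ <-; rewrite linearN. Qed.
Lemma characterM a b : f (a * b) = f a * f b.
Proof. by case: cf => g _ <-; rewrite rmorphM. Qed.
Lemma characterX a n : f (a ^+ n) = f a ^+ n.
Proof. by case: cf => g _ <-; rewrite rmorphXn. Qed.
Lemma characterZ r a : f (r *: a) = r * f a.
Proof. by case: cf => g _ <-; rewrite linearZ. Qed.
Lemma character0 : f 0 = 0.
Proof. by case: cf => g _ <-; rewrite linear0. Qed.

End characters_theory.

(** The sum is [e] times the number of levels among [e], ..., [n * e] strictly below [y]. *)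
Lemma layer_sum_bounds (R : realType) (e y : R) (n : nat) : 0 < e -> 0 <= y ->
  let S := \sum_(i < n) e * (e * i.+1%:R < y)%R%:R in
  S <= y /\ (y <= e * n.+1%:R -> y <= S + e).
Proof.
move=> e0 y0; elim: n => [|n [IH1 IH2]] /=.
  by rewrite big_ord0 add0r mulr1; split.
rewrite big_ord_recr /=; case: ltP => H.
  have -> : \sum_(i < n) e * (e * i.+1%:R < y)%R%:R = e * n%:R.
    rewrite (eq_bigr (fun=> e)) ?sumr_const ?card_ord ?mulr_natr // => i _.
    rewrite (lt_trans _ H) ?mulr1 // ltr_pM2l // ltr_nat ltnS; exact: ltn_ord.
  rewrite -mulrDr natr1; split; first exact: ltW.
  by rewrite -{3}[e]mulr1 -mulrDr natr1.
by rewrite mulr0 addr0; split=> // _; apply: IH2.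
Qed.

Section representation.
Context {R : realType} {T : ptopologicalType} {B : comAlgType R}.
Variables (K : set T) (ev : B -> T -> R) (L : {scalar B}).
Hypotheses (hT : hausdorff_space T) (cK : compact K).
Hypothesis cev : forall b, continuous (ev b).
Hypothesis evK : forall x, K x -> characters B (ev^~ x).
Hypotheses (L1 : L 1 = 1).
Hypothesis Lpos : forall b, (forall x, K x -> 0 <= ev b x) -> 0 <= L b.

Let V : lmodType R := T -> R^o.
Let e : V := fun=> 1.

(** Order all functions on [T] by the cone of those that dominate, on [K], some [ev b] with
    [0 <= L b]. With nonnegative scalars as operators, a total cone above it assigns to each
    function bounded on [K] a value that is linear, monotone and equal to [L b] at [ev b]; [nu] is
    this value at indicators. The last clause is monotonicity for step functions, in the form that
    the layer argument needs. *)
Lemma fin_additive_extension : exists nu : set T -> R,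
  [/\ forall E, 0 <= nu E,
      forall E F, E `&` F = set0 -> nu (E `|` F) = nu E + nu F,
      nu (~` K) = 0, nu setT = 1 &
      forall (b : B) (c M : R) (U : nat -> set T) (n : nat),
        (forall x, K x -> \sum_(i < n) c * (\1_(U i) x : R) <= ev b x + M) ->
        \sum_(i < n) c * nu (U i) <= L b + M].
Proof.
pose G := [set g : V -> V | exists2 r : R, 0 <= r & g = *:%R r].
have GG : commuting_operators G.
  split.
  - by move=> _ [r _ ->] x y; rewrite scalerDr.
  - by move=> _ _ x [r _ ->] [s _ ->]; rewrite !scalerA mulrC.
  - move=> _ _ [r r0 ->] [s s0 ->]; exists (r + s); first exact: addr_ge0.
    by apply/funext => x; rewrite scalerDl.
  - move=> _ _ [r r0 ->] [s s0 ->]; exists (r * s); first exact: mulr_ge0.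
    by apply/funext => x; rewrite /= scalerA.
  - by move=> r r0; exists r.
pose Q0 := [set f : V | exists2 b, 0 <= L b & forall x, K x -> ev b x <= f x].
have cQ0 : operator_cone G Q0.
  split=> [f g [b Lb bf] [c Lc cg]|_ f [r r0 ->] [b Lb bf]].
    exists (b + c); first by rewrite linearD addr_ge0.
    by move=> x Kx; rewrite (characterD (evK Kx)); apply: lerD; [exact: bf|exact: cg].
  exists (r *: b); first by rewrite linearZ mulr_ge0.
  by move=> x Kx; rewrite (characterZ (evK Kx)); apply: ler_wpM2l => //; exact: bf.
have Q0pos (f : V) : (forall x, K x -> 0 <= f x) -> Q0 f.
  move=> f0; exists 0; first by rewrite linear0.
  by move=> x Kx; rewrite (character0 (evK Kx)); exact: f0.
have Q0e : Q0 e by apply: Q0pos => x _; exact: ler01.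
(* If [ev b <= -1] on [K], positivity of [L] at [- b - 1] gives [L b <= -1]. *)
have nQ0 : ~ Q0 (- e).
  move=> [b Lb be].
  have : 0 <= L (- b - 1).
    apply: Lpos => x Kx; rewrite (characterD (evK Kx)) !(characterN (evK Kx)).
    by rewrite (character1 (evK Kx)) subr_ge0 lerNr; exact: be.
  by rewrite linearB linearN L1 /= subr_ge0 lerNr => /(le_trans Lb); rewrite oppr_ge0 ler10.
have [Q [[QD QG] Q0Q nQ tot]] := total_cone_exists GG cQ0 Q0e nQ0.
have QZ (r : R) f : 0 <= r -> Q f -> Q (r *: f).
  by move=> r0 Qf; apply: QG => //; exists r.
pose bdd (f : V) := exists M : R, forall x, K x -> `|f x| <= M.
have bddQ f : bdd f -> exists r : R, Q0 (r *: e - f) /\ Q0 (r *: e + f).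
  move=> [M HM]; exists M; split; apply: Q0pos => x /HM; rewrite ler_norml => /andP[h1 h2].
    have -> : (M *: e - f) x = M * 1 - f x by [].
    by rewrite mulr1 subr_ge0.
  have -> : (M *: e + f) x = M * 1 + f x by [].
  by rewrite mulr1 addrC -lerBlDr sub0r.
have bddB f (y : R) : bdd f -> bdd (f - y *: e).
  move=> [M HM]; exists (M + `|y|) => x Kx.
  have -> : (f - y *: e) x = f x - y * 1 by [].
  by rewrite mulr1 (le_trans (ler_normB _ _))// lerD2r HM.
have ex f : bdd f -> exists y, cone_value Q e f y.
  move=> bf; apply: cone_value_exists => //; first exact: Q0Q.
    by have [r [? ?]] := bddQ _ bf; exists r; split; apply: Q0Q.
  by move=> y; have [|] := tot _ (bddQ _ (bddB _ y bf)); [left|right; rewrite -opprB].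
have bdd1 E : bdd (\1_E : V).
  by exists 1 => x _; rewrite indicE; case: (_ \in _); rewrite ?normr1 ?normr0.
pose nu E := sval (cid (ex _ (bdd1 E))).
have nuP E : cone_value Q e (\1_E : V) (nu E) by rewrite /nu; case: cid.
have mono f g y z : (forall x, K x -> f x <= g x) ->
    cone_value Q e f y -> cone_value Q e g z -> y <= z.
  move=> fg; apply: (cone_value_le QD QZ nQ); apply/Q0Q/Q0pos => x /fg.
  by rewrite -subr_ge0.
have eq f g y z : (forall x, K x -> f x = g x) ->
    cone_value Q e f y -> cone_value Q e g z -> y = z.
  move=> fg cf cg; apply/eqP; rewrite eq_le; apply/andP; split.
    by apply: mono cf cg => x /fg ->.
  by apply: mono cg cf => x /fg ->.
have v1 : cone_value Q e e 1.
  move=> d d0.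
  have -> : e - (1 - d) *: e = d *: e by rewrite scalerBl scale1r subKr.
  have -> : (1 + d) *: e - e = d *: e by rewrite scalerDl scale1r addrC addKr.
  by split; apply: QZ (ltW d0) (Q0Q _ Q0e).
have v0 : cone_value Q e 0 0.
  by have := cone_valueZ QD QZ 0 v1; rewrite scale0r mul0r.
(* Both conditions hold already in [Q0]: the witnesses [b - (L b - d)] and [(L b + d) - b] have
   [L]-value [d]. *)
have vev b : cone_value Q e (ev b : V) (L b).
  move=> d d0; split; apply: Q0Q.
    exists (b - (L b - d) *: 1).
      by rewrite linearB linearZ /= L1 mulr1 subKr ltW.
    move=> x Kx; rewrite (characterD (evK Kx)) (characterN (evK Kx)) (characterZ (evK Kx)).
    by rewrite (character1 (evK Kx)).
  exists ((L b + d) *: 1 - b).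
    by rewrite linearB linearZ /= L1 mulr1 addrC addKr ltW.
  move=> x Kx; rewrite (characterD (evK Kx)) (characterN (evK Kx)) (characterZ (evK Kx)).
  by rewrite (character1 (evK Kx)).
exists nu; split.
- by move=> E; apply: mono v0 (nuP E) => x _; rewrite indicE ler0n.
- move=> E F EF; apply: eq (nuP _) (cone_valueD QD (nuP E) (nuP F)) => x _.
  have -> : ((\1_E : V) + \1_F) x = \1_E x + \1_F x by [].
  rewrite !indicE in_setU -natrD; have := congr1 (fun D => x \in D) EF.
  by rewrite /= in_setI in_set0; case: (x \in E); case: (x \in F).
- apply: eq (nuP _) v0 => x Kx; rewrite indicE memNset//; exact.
- by apply: eq (nuP _) v1 => x Kx; rewrite indicE mem_set.
- move=> b c M U n H.
  have vS : cone_value Q e (\sum_(i < n) c *: (\1_(U i) : V)) (\sum_(i < n) c * nu (U i)).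
    elim: n {H} => [|n IH]; first by rewrite !big_ord0.
    rewrite !big_ord_recr /=; apply: cone_valueD => //; exact: cone_valueZ.
  have := cone_valueD QD (vev b) (cone_valueZ QD QZ M v1).
  rewrite mulr1 => vb; apply: mono vS vb => x Kx.
  have -> : ((ev b : V) + M *: e) x = ev b x + M * 1 by [].
  rewrite mulr1; apply: le_trans (H _ Kx).
  by rewrite fct_sumE.
Qed.

Local Open Scope ereal_scope.

(** The measure is bounded by [nu] on open sets only, but the layers of a continuous function are
    open. Hence the layer sum of [ev b + M] has integral at most its [nu]-analogue, which is at most
    [L b + M]. *)
Lemma radon_representation : exists mu : {measure set (borel T) -> \bar R},
  radon_on K mu /\ forall b, (L b)%:E = \int[mu]_(x in K) (ev b x)%:E.
Proof.
have [nu [nu_ge0 nuU nuK nuT nuS]] := fin_additive_extension.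
have [mu [muK muT muU]] := content_measure hT cK nu_ge0 nuU nuK.
exists mu; split=> //.
have mK : measurable (K : set (borel T)) by apply: borel_closed; exact: compact_closed.
have muK1 : mu K = 1.
  have : mu (K `|` ~` K) = mu K + mu (~` K).
    by rewrite measureU ?setICr//; exact: measurableC.
  by rewrite setUv muK.2 adde0 muT nuT.
have Kfin : mu K < +oo by rewrite muK1 ltry.
have intcst (r : R) : \int[mu]_(x in K) r%:E = r%:E.
  by have := integral_cst mu mK r%:E; rewrite muK1 mule1.
have intb b : mu.-integrable K (EFin \o ev b).
  exact: continuous_integrable_on_compact.
(* One inequality is enough, since it also applies to [- b]. *)
suff le b : \int[mu]_(x in K) (ev b x)%:E <= (L b)%:E.
  move=> b; apply/eqP; rewrite eq_le le andbT.
  have := le (- b)%R; rewrite linearN /= EFinN.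
  have -> : \int[mu]_(x in K) (ev (- b)%R x)%:E = - \int[mu]_(x in K) (ev b x)%:E.
    rewrite -integralN; last exact: (integrable_add_def mK (intb b)).
    by apply: eq_integral => x /set_mem Kx; rewrite (characterN (evK Kx)) EFinN.
  by rewrite leeN2.
have [M M0 HM] := compact_bound cK (@cev b).
have ctM : continuous (fun x => (ev b x + M)%R).
  by move=> x; apply: cvgD; [exact: cev|exact: cvg_cst].
suff : \int[mu]_(x in K) (ev b x + M)%:E <= (L b + M)%:E.
  under eq_integral do rewrite EFinD.
  rewrite integralD//; first 1 last.
  - exact: intb.
  - exact: (continuous_integrable_on_compact hT cK Kfin (cst_continuous (x := M))).
  by rewrite intcst EFinD leeD2rE.
apply/lee_addgt0Pr => d d0.
(* Enough layers of height [d] to exhaust the range of [ev b + M] on [K], which lies between 0 and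
   [2 * M]. *)
pose n := (Num.truncn (2 * M / d)).
have nP : (2 * M <= d * n.+1%:R)%R.
  by rewrite [leRHS]mulrC -ler_pdivrMr// ltW// truncnS_gt.
pose U i := [set x | (d * i.+1%:R < ev b x + M)%R].
have oU i : open (U i).
  have -> : U i = (fun x => (ev b x + M)%R) @^-1` `](d * i.+1%:R)%R, +oo[%classic.
    by apply/seteqP; split => x; rewrite /U /= in_itv /= andbT.
  by apply: open_comp => // x _; exact: ctM.
have layer x : K x -> let S := (\sum_(i < n) d * (\1_(U i) x : R))%R in
    (S <= ev b x + M /\ ev b x + M <= S + d)%R.
  move=> Kx; have := HM _ Kx; rewrite ler_norml => /andP[h1 h2].
  have y0 : (0 <= ev b x + M)%R by rewrite addrC -lerBlDl sub0r.
  have [] := layer_sum_bounds n d0 y0.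
  have -> : (\sum_(i < n) d * (d * i.+1%:R < ev b x + M)%R%:R =
             \sum_(i < n) d * (\1_(U i) x : R))%R.
    apply: eq_bigr => i _; rewrite indicE; congr (_ * _%:R)%R.
    by congr nat_of_bool; apply/idP/idP => h; [exact: mem_set|exact: (set_mem h)].
  move=> S1 S2; split=> //; apply: S2; apply: le_trans nP.
  by rewrite mulr_natl mulr2n lerD2r.
have mU i : measurable (U i : set (borel T)) by exact: borel_open.
apply: (@le_trans _ _ (\int[mu]_(x in K)
    (\sum_(i < n) (d%:E * (\1_(U i) x : R)%:E) + d%:E))).
  apply: ge0_le_integral => //.
  - move=> x Kx; rewrite lee_fin addrC -lerBlDl sub0r.
    by have := HM _ Kx; rewrite ler_norml => /andP[].
  - by apply/measurable_EFinP; exact: continuous_borel_measurable.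
  - apply: emeasurable_funD => //; apply: emeasurable_sum => i.
    by apply: measurable_funeM; apply/measurable_EFinP; exact: measurable_indic.
  - move=> x Kx; have [_] := layer _ Kx.
    rewrite -lee_fin EFinD => /le_trans; apply; rewrite EFinD -sumEFin.
    by under eq_bigr do rewrite EFinM.
rewrite ge0_integralD//; first 1 last.
- by move=> x Kx; apply: sume_ge0 => i _; apply: mule_ge0; rewrite lee_fin ?indicE ?ler0n// ltW.
- apply: emeasurable_sum => i.
  by apply: measurable_funeM; apply/measurable_EFinP; exact: measurable_indic.
- by move=> x Kx; rewrite lee_fin ltW.
rewrite intcst; apply: leeD => //.
rewrite ge0_integral_sum//; first 1 last.
- move=> i; apply: measurable_funeM; apply/measurable_EFinP; exact: measurable_indic.
- by move=> i x Kx; apply: mule_ge0; rewrite lee_fin ?indicE ?ler0n// ltW.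
apply: (@le_trans _ _ (\sum_(i < n) (d * nu (U i))%:E)).
  apply: lee_sum => i _; rewrite ge0_integralZl_EFin//; first 1 last.
  - by apply/measurable_EFinP; exact: measurable_indic.
  - exact: ltW.
  rewrite integral_indic// EFinM; apply: lee_wpmul2l; first by rewrite lee_fin ltW.
  apply: le_trans (muU _ (oU i)); apply: le_measure.
  - by apply/mem_set; exact: measurableI.
  - exact/mem_set.
  - exact: subIsetl.
rewrite sumEFin lee_fin; apply: nuS => x Kx; exact: (layer _ Kx).1.
Qed.

End representation.

(** * Uniqueness of representing measures *)

Section step_polynomials.
Context {R : realType}.
Implicit Types t y : R.

Lemma bernoulli_le y (N : nat) : -1 <= y -> 1 + N%:R * y <= (1 + y) ^+ N.
Proof.
move=> y1; elim: N => [|N IH]; first by rewrite mul0r addr0 expr0.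
have y0 : 0 <= 1 + y by rewrite -lerBlDl sub0r.
rewrite exprS; apply: le_trans (ler_wpM2l y0 IH).
have -> : (1 + y) * (1 + N%:R * y) = 1 + N.+1%:R * y + N%:R * y ^+ 2.
  by rewrite -natr1; ring.
by rewrite lerDl mulr_ge0 ?sqr_ge0.
Qed.

(* With [p = (1 - t) / 2], the first factor tends to 1 for [p < 1/2] and to 0
   for [p > 1/2]; the second one tends to 1 for [t != 0] and vanishes at 0. *)
Definition step_poly (n : nat) (t : R) : R :=
  (1 - (2^-1 * (1 - t)) ^+ n) ^+ (2 ^ n) * (1 - (1 - t ^+ 2) ^+ n).

Lemma step_poly_bounds n t : `|t| <= 1 -> 0 <= step_poly n t <= 1.
Proof.
rewrite ler_norml => /andP[t1 t2]; rewrite /step_poly.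
have p0 : 0 <= 2^-1 * (1 - t) by rewrite mulr_ge0// subr_ge0.
have p1 : 2^-1 * (1 - t) <= 1 by rewrite mulrC ler_pdivrMr//; lra.
have q0 : 0 <= 1 - t ^+ 2 by nra.
have q1 : 1 - t ^+ 2 <= 1 by rewrite gerBl sqr_ge0.
have h (z : R) : 0 <= z -> z <= 1 -> (0 <= 1 - z ^+ n) && (1 - z ^+ n <= 1).
  by move=> z0 z1; rewrite subr_ge0 exprn_ile1 //= gerBl exprn_ge0.
have /andP[a0 a1] := h _ p0 p1; have /andP[b0 b1] := h _ q0 q1.
by rewrite mulr_ge0 ?exprn_ge0 //= mulr_ile1 ?exprn_ge0 ?exprn_ile1.
Qed.

(** Put [p = (1 - t) / 2]. For [t > 0], Bernoulli gives [(1 - p ^+ n) ^+ (2 ^ n) >= 1 - (2 * p) ^+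
    n] with [2 * p < 1]. For [t < 0], from [(1 - p ^+ n) * (1 + p ^+ n) <= 1] and Bernoulli the
    first factor is at most [(2 * p) ^- n] with [2 * p > 1]. At [t = 0] the second factor is 0. *)
Lemma step_poly_cvg t : `|t| <= 1 ->
  step_poly n t @[n --> \oo] --> ((0 < t)%R%:R : R).
Proof.
move=> tb; have := tb; rewrite ler_norml => /andP[t1 t2].
pose p := 2^-1 * (1 - t).
have p0 : 0 <= p by rewrite mulr_ge0// subr_ge0.
have p1 : p <= 1 by rewrite /p mulrC ler_pdivrMr//; lra.
have pn n : 0 <= p ^+ n <= 1 by rewrite exprn_ge0 // exprn_ile1.
have w01 n : 0 <= 1 - (1 - t ^+ 2) ^+ n <= 1.
  have q0 : 0 <= 1 - t ^+ 2 by nra.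
  by rewrite subr_ge0 exprn_ile1 ?gerBl ?sqr_ge0 //= exprn_ge0.
case: (ltgtP 0 t) => t0.
- have cw : 1 - (1 - t ^+ 2) ^+ n @[n --> \oo] --> (1 : R).
    rewrite -[X in _ --> X]subr0; apply: cvgB; first exact: cvg_cst.
    apply: cvg_expr; rewrite ger0_norm; first by nra.
    by nra.
  have cu : (1 - p ^+ n) ^+ (2 ^ n) @[n --> \oo] --> (1 : R).
    have cl : 1 - (2 * p) ^+ n @[n --> \oo] --> (1 : R).
      rewrite -[X in _ --> X]subr0; apply: cvgB; first exact: cvg_cst.
      by apply: cvg_expr; rewrite ger0_norm /p mulVKf ?gtrBl ?subr_ge0 ?pnatr_eq0.
    have cr : (fun=> 1) @ \oo --> (1 : R) by exact: cvg_cst.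
    apply: (squeeze_cvgr _ cl cr); apply: nearW => n.
    have /andP[h0 h1] := pn n; apply/andP; split.
      have := @bernoulli_le (- p ^+ n) (2 ^ n).
      rewrite lerN2 => /(_ h1); rewrite mulrN natrX -exprMn; exact.
    by rewrite exprn_ile1 ?subr_ge0 // gerBl.
  have := cvgM cu cw; rewrite mulr1; exact.
- have cz : (2 * p)^-1 ^+ n @[n --> \oo] --> (0 : R).
    have p2 : 1 < 2 * p by rewrite /p mulVKf ?pnatr_eq0//; lra.
    have p20 : 0 < 2 * p by exact: lt_trans p2.
    by apply: cvg_expr; rewrite gtr0_norm ?invr_gt0// invf_lt1.
  have c0 : (fun=> 0) @ \oo --> (0 : R) by exact: cvg_cst.
  apply: (squeeze_cvgr _ c0 cz); apply: nearW => n.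
  have /andP[h0 h1] := pn n; have /andP[w0 w1] := w01 n.
  have u0 : 0 <= (1 - p ^+ n) ^+ (2 ^ n) by rewrite exprn_ge0 // subr_ge0.
  apply/andP; split; first exact: mulr_ge0.
  apply: (@le_trans _ _ ((1 - p ^+ n) ^+ (2 ^ n))); first by rewrite ler_piMr.
  have p2 : 0 < 2 * p by rewrite /p mulVKf ?pnatr_eq0//; lra.
  rewrite exprVn -[leRHS]mul1r ler_pdivlMr ?exprn_gt0//.
  apply: (@le_trans _ _ ((1 - p ^+ n) ^+ (2 ^ n) * (1 + p ^+ n) ^+ (2 ^ n))).
    rewrite ler_wpM2l//.
    have := @bernoulli_le (p ^+ n) (2 ^ n).
    rewrite natrX -exprMn => H; apply: le_trans (H _); first by rewrite lerDr.
    by apply: le_trans h0; rewrite oppr_le0.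
  rewrite -exprMn exprn_ile1 //.
    by rewrite mulr_ge0 ?subr_ge0 ?addr_ge0.
  have -> : (1 - p ^+ n) * (1 + p ^+ n) = 1 - (p ^+ n) ^+ 2 by ring.
  by rewrite gerBl sqr_ge0.
- rewrite -t0; rewrite (_ : (fun n => _) = fun=> 0); first exact: cvg_cst.
  by apply/funext => n; rewrite /step_poly expr0n subr0 expr1n subrr mulr0.
Qed.

End step_polynomials.

(** * Approximation of indicators and comparison of two measures *)

Section uniqueness.
Context {R : realType} {T : ptopologicalType} {B : comAlgType R}.
Variables (K : set T) (ev : B -> T -> R).
Hypotheses (hT : hausdorff_space T) (cK : compact K).
Hypothesis cev : forall b, continuous (ev b).
Hypothesis evK : forall x, K x -> characters B (ev^~ x).
Hypothesis sep : forall x y, K x -> K y -> x != y -> exists b, ev b x != ev b y.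

(** Bounded pointwise convergence on [K] is what dominated convergence needs, so two measures with
    the same integrals agree on measurable approximable sets. *)
Definition approximable (V : set T) : Prop :=
  exists (a : nat -> B) (C : R),
    (forall n x, K x -> `|ev (a n) x| <= C) /\
    (forall x, K x -> ev (a n) x @[n --> \oo] --> (\1_V x : R)).

Lemma approximableT : approximable setT.
Proof.
exists (fun=> 1), 1; split=> [n x Kx|x Kx].
  by rewrite (character1 (evK Kx)) normr1.
rewrite indicT; under eq_fun do rewrite (character1 (evK Kx)); exact: cvg_cst.
Qed.

Lemma approximableI V W : approximable V -> approximable W -> approximable (V `&` W).
Proof.
move=> [a [C [aC aV]]] [b [D [bD bW]]].
exists (fun n => a n * b n), (C * D); split=> [n x Kx|x Kx].
  by rewrite (characterM (evK Kx)) normrM ler_pM // ?aC ?bD.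
rewrite indicI; under eq_fun do rewrite (characterM (evK Kx)).
by apply: cvgM; [exact: aV|exact: bW].
Qed.

Lemma approximableC V : approximable V -> approximable (~` V).
Proof.
move=> [a [C [aC aV]]]; exists (fun n => 1 - a n), (1 + C); split=> [n x Kx|x Kx].
  rewrite (characterD (evK Kx)) (characterN (evK Kx)) (character1 (evK Kx)).
  by rewrite (le_trans (ler_normB _ _))// normr1 lerD2l aC.
have -> : \1_(~` V) x = 1 - \1_V x :> R.
  by rewrite indicC indicE; case: (x \in V); rewrite /= ?subr0 ?subrr.
under eq_fun do rewrite (characterD (evK Kx)) (characterN (evK Kx)) (character1 (evK Kx)).
by apply: cvgB; [exact: cvg_cst|exact: aV].
Qed.

Lemma approximableU V W : approximable V -> approximable W -> approximable (V `|` W).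
Proof.
move=> aV aW; rewrite -[V `|` W]setCK setCU.
by apply/approximableC/approximableI; apply: approximableC.
Qed.

Lemma approximable_pos b : approximable [set x | 0 < ev b x].
Proof.
have [M M0 HM] := compact_bound cK (@cev b).
(* Rescaling brings the values on [K] into [[-1, 1]], where the step polynomials converge. *)
pose c := M^-1 *: b.
exists (fun n => (1 - ((2^-1 : R)%:A * (1 - c)) ^+ n) ^+ (2 ^ n) *
  (1 - (1 - c ^+ 2) ^+ n)), 1.
have evE n x : K x -> ev ((1 - ((2^-1 : R)%:A * (1 - c)) ^+ n) ^+ (2 ^ n) *
    (1 - (1 - c ^+ 2) ^+ n)) x = step_poly n (M^-1 * ev b x).
  move=> /evK ex.
  rewrite !(characterM ex, characterX ex, characterD ex, characterN ex,
    character1 ex, characterZ ex).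
  by rewrite /step_poly mulr1.
have small x : K x -> `|M^-1 * ev b x| <= 1.
  move=> Kx; rewrite normrM ger0_norm ?invr_ge0 ?(ltW M0)//.
  by rewrite mulrC ler_pdivrMr// mul1r HM.
split=> [n x Kx|x Kx].
  have /andP[h0 h1] := step_poly_bounds n (small _ Kx).
  by rewrite evE// ger0_norm.
under eq_fun do rewrite evE//.
have -> : \1_[set x | 0 < ev b x] x = (0 < M^-1 * ev b x)%R%:R :> R.
  rewrite indicE pmulr_rgt0 ?invr_gt0//; congr (_%:R); congr nat_of_bool.
  by apply/idP/idP => h; [exact: (set_mem h)|exact: mem_set].
exact: step_poly_cvg (small _ Kx).
Qed.

(** For each [y] in [K] outside [U] choose [b y] positive at [x] and negative at [y]. Finitely many
    of the sets [{b y < 0}] cover the compact set [K] minus [U]; [V] is the intersection of the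
    corresponding sets [{b y > 0}]. *)
Lemma approximable_nbhs (U : set T) x : open U -> K x -> U x ->
  exists V, [/\ open V, approximable V, V x & V `&` K `<=` U].
Proof.
move=> oU Kx Ux.
have sep' y : exists b, (K `\` U) y -> 0 < ev b x /\ 0 < ev (- b) y.
  have [[Ky nUy]|] := pselect ((K `\` U) y); last by exists 0.
  have xy : x != y by apply: contra_notN nUy => /eqP <-.
  have [b bxy] := sep Kx Ky xy.
  (* Subtracting the midpoint [m] and multiplying by the difference [d] gives the values
     [d ^+ 2 / 2] at [x] and [- d ^+ 2 / 2] at [y], whatever the sign of [d]. *)
  pose d := (ev b x - ev b y); pose m := (ev b x + ev b y) / 2.
  exists (d *: (b - m%:A)) => _.
  rewrite (characterN (evK Ky)) !(characterZ (evK Kx)) !(characterZ (evK Ky)).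
  rewrite !(characterD (evK Kx)) !(characterD (evK Ky)) !(characterN (evK Kx)).
  rewrite !(characterN (evK Ky)) !(characterZ (evK Kx)) !(characterZ (evK Ky)).
  rewrite (character1 (evK Kx)) (character1 (evK Ky)) mulr1.
  have -> : d * (ev b x - m) = d * (d / 2) by rewrite /m /d; field.
  have -> : - (d * (ev b y - m)) = d * (d / 2) by rewrite /m /d; field.
  have d2 : 0 < d * (d / 2).
    by rewrite mulrA divr_gt0 // -expr2 exprn_even_gt0 //= /d subr_eq0.
  by [].
have [b bP] := choice sep'.
have oP c : open [set z | 0 < ev c z].
  have -> : [set z | 0 < ev c z] = ev c @^-1` `]0, +oo[%classic.
    by apply/seteqP; split=> z /=; rewrite in_itv /= andbT.
  by apply: open_comp => // z _; exact: cev.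
have cKU : compact (K `\` U).
  by rewrite setDE; apply: compact_closedI => //; exact: open_closedC.
have := cKU; rewrite compact_cover => /(_ T (K `\` U) (fun y => [set z | 0 < ev (- b y) z])).
move=> [i Di|y KUy|D' D'KU cov].
- exact: oP.
- by exists y => //; have [] := bP _ KUy.
have [V [oV aV Vx VP]] : exists V, [/\ open V, approximable V, V x &
    forall z, V z -> forall y, y \in enum_fset D' -> 0 < ev (b y) z].
  have : {subset enum_fset D' <= K `\` U} by move=> y /D'KU.
  elim: (enum_fset D') => [|y s IH] sub.
    by exists setT; split=> //; [exact: openT|exact: approximableT].
  have [|V [oV aV Vx VP]] := IH; first by move=> z zs; apply: sub; rewrite in_cons zs orbT.
  have KUy : (K `\` U) y by apply: set_mem; apply: sub; rewrite in_cons eqxx.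
  exists (V `&` [set z | 0 < ev (b y) z]); split.
  - exact: openI.
  - by apply: approximableI => //; exact: approximable_pos.
  - by split=> //; have [] := bP _ KUy.
  - by move=> z [Vz yz] w; rewrite in_cons => /orP[/eqP->//|]; exact: VP.
exists V; split=> // z [Vz Kz]; apply: contrapT => nUz.
have [y /= yD'] := cov z (conj Kz nUz).
by rewrite (characterN (evK Kz)) oppr_gt0 ltNge ltW // VP.
Qed.

Local Open Scope ereal_scope.

Section two_measures.
Variables mu nu : {measure set (borel T) -> \bar R}.
Hypotheses (muK : radon_on K mu) (nuK : radon_on K nu).
Hypothesis eq_int : forall b,
  \int[mu]_(x in K) (ev b x)%:E = \int[nu]_(x in K) (ev b x)%:E.

Let mK : measurable (K : set (borel T)).
Proof. by apply: borel_closed; exact: compact_closed. Qed.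

Lemma approximable_integral_cvg (la : {measure set (borel T) -> \bar R})
    (V : set T) (a : nat -> B) (C : R) : la K < +oo ->
  measurable (V : set (borel T)) ->
  (forall n x, K x -> (`|ev (a n) x| <= C)%R) ->
  (forall x, K x -> ev (a n) x @[n --> \oo] --> (\1_V x : R)) ->
  \int[la]_(x in K) (ev (a n) x)%:E @[n --> \oo] --> la (V `&` K).
Proof.
move=> Kfin mV aC aV.
have [] := @dominated_convergence _ (borel T) R la K mK (fun n x => (ev (a n) x)%:E)
  (fun x => (\1_V x)%:E) (fun=> C%:E).
- by move=> n; apply/measurable_EFinP; exact: continuous_borel_measurable.
- by apply/measurable_EFinP; exact: measurable_indic.
- by apply: aeW => x Kx; apply: cvg_EFin; [exact: nearW|exact: aV].
- exact: (continuous_integrable_on_compact hT cK Kfin (cst_continuous (x := C))).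
- by apply: aeW => x n Kx; rewrite abse_EFin lee_fin aC.
by move=> _ _; rewrite integral_indic.
Qed.

Lemma approximable_measure (V : set T) : measurable (V : set (borel T)) ->
  approximable V -> mu (V `&` K) = nu (V `&` K).
Proof.
move=> mV [a [C [aC aV]]].
have Kfin (la : {measure set (borel T) -> \bar R}) : radon_on K la -> la K < +oo.
  by move=> [[+ _] _]; apply.
have c1 := approximable_integral_cvg (Kfin _ muK) mV aC aV.
have c2 := approximable_integral_cvg (Kfin _ nuK) mV aC aV.
rewrite -(cvg_lim _ c1)// -(cvg_lim _ c2)//; congr (limn _).
by apply/funext => n; exact: eq_int.
Qed.

(** By compactness a finite union [W] of approximable open sets covers [C] and, within [K], avoids
    [D]; the two measures agree on the part of [W] in [K]. *)
Lemma compact_measure_le (C D : set T) : compact C -> C `<=` K -> closed D ->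
  C `&` D = set0 -> mu C <= nu (~` D).
Proof.
move=> cC CK cD CD0.
have oD : open (~` D) by exact: closed_openC.
have nbh x : exists V, open V /\ approximable V /\ (C x -> V x /\ V `&` K `<=` ~` D).
  have [Cx|nCx] := pselect (C x); last first.
    by exists setT; split; [exact: openT|split; [exact: approximableT|]].
  have nDx : (~` D) x by move=> Dx; have : (C `&` D) x by []; rewrite CD0.
  have [V [oV aV Vx VK]] := approximable_nbhs oD (CK _ Cx) nDx.
  by exists V.
have [V VP] := choice nbh.
have := cC; rewrite compact_cover => /(_ T C V (fun x _ => (VP x).1)) [x Cx|D' D'C cov].
  by exists x => //; exact: ((VP x).2.2 Cx).1.
have [W [oW aW CW WD]] : exists W, [/\ open W, approximable W,
    \bigcup_(x in [set` D']) V x `<=` W & W `&` K `<=` ~` D].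
  have [W [oW aW sW WD]] : exists W, [/\ open W, approximable W,
      forall x, x \in enum_fset D' -> V x `<=` W & W `&` K `<=` ~` D].
    have : {subset enum_fset D' <= C} by move=> y /D'C.
    elim: (enum_fset D') => [|y s IH] sub.
      exists set0; split=> //; first exact: open0.
        rewrite -[set0]setCK; apply: approximableC; rewrite setC0; exact: approximableT.
      by move=> x [].
    have [|W [oW aW sW WD]] := IH.
      by move=> z zs; apply: sub; rewrite in_cons zs orbT.
    have Cy : C y by apply: set_mem; apply: sub; rewrite in_cons eqxx.
    have [oV [aV /(_ Cy)[_ VD]]] := VP y.
    exists (W `|` V y); split.
    - exact: openU.
    - exact: approximableU.
    - move=> z; rewrite in_cons => /orP[/eqP->|/sW zW]; first exact: subsetUr.
      by apply: subset_trans zW _; left.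
    - by move=> z [[Wz|Vz] Kz]; [apply: WD|apply: VD].
  by exists W; split=> // z [x xD' Vz]; exact: sW xD' _ Vz.
have mW : measurable (W : set (borel T)) by exact: borel_open.
have mC : measurable (C : set (borel T)) by apply: borel_closed; exact: compact_closed.
have mD : measurable (~` D : set (borel T)) by exact: borel_open.
apply: (@le_trans _ _ (mu (W `&` K))).
  apply: le_measure; [exact/mem_set|by apply/mem_set; exact: measurableI|].
  by move=> x Cx; split; [apply: CW; exact: cov|exact: CK].
rewrite approximable_measure//; apply: le_measure => //; last exact/mem_set.
by apply/mem_set; exact: measurableI.
Qed.

(** By inner regularity of [mu] it suffices to treat a compact [C] inside [K]. For every compact [D]
    disjoint from [C], [mu C <= nu setT - nu D]; inner regularity of [nu] at the complement of [C]
    turns this into [mu C <= nu C]. *)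
Lemma radon_le (E : set (borel T)) : measurable E -> mu E <= nu E.
Proof.
move=> mE; have [[mufin muR] mu0] := muK; have [[nufin nuR] nu0] := nuK.
have mKc : measurable (~` K : set (borel T)) by exact: measurableC.
have totE (la : {measure set (borel T) -> \bar R}) : la (~` K) = 0 -> la setT = la K.
  move=> la0; have : la (K `|` ~` K) = la K + la (~` K).
    by rewrite measureU ?setICr.
  by rewrite setUv la0 adde0.
rewrite muR//; apply: ge_ereal_sup => _ [C0 [cC0 C0E] <-].
pose C := C0 `&` K.
have clC0 : closed C0 by exact: compact_closed.
have cC : compact C by rewrite /C setIC; apply: compact_closedI.
have mC0 : measurable (C0 : set (borel T)) by exact: borel_closed.
have mC : measurable (C : set (borel T)) by exact: measurableI.
apply: (@le_trans _ _ (mu C)).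
  apply: (@le_trans _ _ (mu (C `|` ~` K))).
    apply: le_measure; [exact/mem_set|by apply/mem_set; exact: measurableU|].
    by move=> x C0x; have [Kx|nKx] := pselect (K x); [left|right].
  apply: le_trans (measureU2 _ mC mKc) _.
  by rewrite -[leRHS]adde0; apply: leeD => //; rewrite le_eqVlt; apply/orP; left; apply/eqP.
apply: (@le_trans _ _ (nu C)); last first.
  by apply: le_measure; [exact/mem_set|exact/mem_set|move=> x [/C0E]].
have nT : nu setT \is a fin_num.
  by rewrite ge0_fin_numE// (totE nu nu0) nufin.
have nfin (F : set (borel T)) : measurable F -> nu F \is a fin_num.
  move=> mF; rewrite ge0_fin_numE//; apply: le_lt_trans (_ : nu setT < +oo).
    by apply: le_measure => //; exact/mem_set.
  by rewrite -ge0_fin_numE.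
have nC (F : set (borel T)) : measurable F -> nu F + nu (~` F) = nu setT.
  by move=> mF; rewrite -measureU ?setUv ?setICr//; exact: measurableC.
have mfinC : mu C \is a fin_num by rewrite ge0_fin_numE// mufin.
have H : nu (~` C) <= nu setT - mu C.
  rewrite nuR; last exact: measurableC.
  apply: ge_ereal_sup => _ [D [cD DC] <-].
  have mD : measurable (D : set (borel T)) by apply: borel_closed; exact: compact_closed.
  have CD0 : C `&` D = set0 by apply/seteqP; split=> // x [Cx /DC].
  have := compact_measure_le cC (@subIsetr _ _ _) (compact_closed hT cD) CD0.
  rewrite leeBrDr// -(nC D mD) => h; apply: leeD => //.
rewrite -(leeD2rE _ _ (nfin _ (measurableC mC))) nC//.
by rewrite addeC -leeBrDr.
Qed.

End two_measures.

Lemma radon_on_unique (mu nu : {measure set (borel T) -> \bar R}) :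
  radon_on K mu -> radon_on K nu ->
  (forall b, \int[mu]_(x in K) (ev b x)%:E = \int[nu]_(x in K) (ev b x)%:E) ->
  forall E : set (borel T), measurable E -> nu E = mu E.
Proof.
move=> muK nuK eq_int E mE; apply/eqP.
by rewrite eq_le !radon_le.
Qed.

End uniqueness.

(** * Compactness of the space of bounded characters *)

Section evaluation.
Context {R : realType} {A : comAlgType R}.

Definition evaluation (a : A) (f : {ptws A -> R}) : R := f a.

Lemma evaluation_continuous a : continuous (evaluation a).
Proof. by move=> f; exact: (@proj_continuous A (fun=> R) a f). Qed.

Lemma ptws_hausdorff : hausdorff_space {ptws A -> R}.
Proof. by apply: (@hausdorff_product A (fun=> R)) => x; exact: Rhausdorff. Qed.

(** Each identity that defines a character says that a continuous function of finitely many
    evaluations vanishes. *)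
Lemma characters_closed : closed (characters A : set {ptws A -> R}).
Proof.
have zero_closed (g : {ptws A -> R} -> R) : continuous g -> closed [set f | g f = 0].
  by move=> cg; apply: (preimage_closed (D := [set x : R | x = 0])) => [? _|];
    [exact: cg|exact: closed_eq].
pose E1 := [set f : {ptws A -> R} | f 1 - 1 = 0].
pose E2 (i : R * A * A) := [set f : {ptws A -> R} |
  f (i.1.1 *: i.1.2 + i.2) - (i.1.1 * f i.1.2 + f i.2) = 0].
pose E3 (i : A * A) := [set f : {ptws A -> R} | f (i.1 * i.2) - f i.1 * f i.2 = 0].
have -> : characters A = E1 `&` (\bigcap_(i in setT) E2 i) `&` (\bigcap_(i in setT) E3 i).
  apply/seteqP; split=> f.
    move=> /charactersP[f1 fL fM]; split; first split.
    - by rewrite /E1 /= f1 subrr.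
    - by move=> [[r x] y] _; rewrite /E2 /= fL subrr.
    - by move=> [x y] _; rewrite /E3 /= fM subrr.
  move=> [[f1 fL] fM]; apply/charactersP; split.
  - by apply/eqP; rewrite -subr_eq0; apply/eqP.
  - by move=> r x y; apply/eqP; rewrite -subr_eq0; apply/eqP; exact: (fL (r, x, y)).
  - by move=> x y; apply/eqP; rewrite -subr_eq0; apply/eqP; exact: (fM (x, y)).
have ec a (f : {ptws A -> R}) : continuous_at f (evaluation a).
  exact: evaluation_continuous.
have cc r (f : {ptws A -> R}) : continuous_at f (fun=> r : R) by exact: cst_continuous.
apply: closedI; first apply: closedI.
- apply: (zero_closed (fun f => evaluation 1 f - 1)) => f.
  exact: (continuousB (ec 1 f) (cc 1 f)).
- apply: closed_bigI => -[[r x] y] _.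
  apply: (zero_closed (fun f => evaluation (r *: x + y) f -
    (r * evaluation x f + evaluation y f))) => f.
  exact: (continuousB (ec _ f) (continuousD (continuousM (cc r f) (ec x f)) (ec y f))).
- apply: closed_bigI => -[x y] _.
  apply: (zero_closed (fun f => evaluation (x * y) f - evaluation x f * evaluation y f)) => f.
  exact: (continuousB (ec _ f) (continuousM (ec x f) (ec y f))).
Qed.

Definition bounded_characters (v : A -> R) : set {ptws A -> R} :=
  [set f | characters A f /\ forall a, `|f a| <= v a].

(** A closed part of a product of segments, compact by Tychonoff's theorem. *)
Lemma bounded_characters_compact v : compact (bounded_characters v).
Proof.
have cbox : compact [set f : {ptws A -> R} | forall a, `[- v a, v a]%classic (f a)].
  by apply: (@tychonoff A (fun=> R) (fun a => `[- v a, v a]%classic)) => a; exact: segment_compact.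
have -> : bounded_characters v =
    [set f : {ptws A -> R} | forall a, `[- v a, v a]%classic (f a)] `&` characters A.
  apply/seteqP; split=> f [h1 h2]; split=> // a.
    by rewrite /= in_itv /= -ler_norml; exact: h2.
  by have := h1 a; rewrite /= in_itv /= -ler_norml.
by apply: compact_closedI => //; exact: characters_closed.
Qed.

End evaluation.

(** * The growth bound and the existence of a representing measure *)

Section growth.
Context {R : realType} {A : comAlgType R} (L : {scalar A}).
Hypotheses (L1 : L 1 = 1) (psdL : psd L).

Lemma psd_even_ge0 a n : 0 <= L (a ^+ (2 * n)).
Proof. by rewrite mulnC exprM; exact: psdL. Qed.

Lemma vL_le a (c : R) : 0 <= c ->
  (forall n, L (a ^+ (2 * n + 2)) <= c ^+ 2 * L (a ^+ (2 * n))) ->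
  (vL L a <= c%:E)%E.
Proof.
move=> c0 H; have -> : c%:E = sqrte (c ^+ 2)%:E.
  by rewrite /= sqrtr_sqr ger0_norm.
rewrite /vL lee_sqrt ?lee_fin ?sqr_ge0//; apply: ge_ereal_sup => _ [n /= Ln <-].
by rewrite lee_fin ler_pdivrMr ?H// lt_def Ln psd_even_ge0.
Qed.

Lemma vL_growth a n : (vL L a < +oo)%E ->
  L (a ^+ (2 * n)) <= fine (vL L a) ^+ (2 * n).
Proof.
move=> vfin.
set S := [set (L (a ^+ (2 * n + 2)) / L (a ^+ (2 * n)))%:E |
      n in [set n : nat | L (a ^+ (2 * n)) != 0]].
have Sn m : L (a ^+ (2 * m)) != 0 ->
    ((L (a ^+ (2 * m + 2)) / L (a ^+ (2 * m)))%:E <= ereal_sup S)%E.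
  by move=> Lm; apply: ereal_sup_ubound; exists m.
(* The index [n = 0] is admissible because [L 1 = 1]; it contributes [L (a ^+ 2)]. *)
have S0 : (0 <= ereal_sup S)%E.
  apply: le_trans (Sn 0%N _); last by rewrite muln0 expr0 L1 oner_eq0.
  by rewrite muln0 expr0 L1 divr1 add0n lee_fin; exact: psdL.
have vE : vL L a = sqrte (ereal_sup S) by [].
have Sfin : ereal_sup S \is a fin_num.
  by rewrite -sqrte_fin_num// -vE ge0_fin_numE// sqrte_ge0.
have v2 : ((fine (vL L a)) ^+ 2)%:E = ereal_sup S.
  by rewrite -(sqr_sqrte S0) -vE -{2}(@fineK _ (vL L a)) // vE sqrte_fin_num.
elim: n => [|n IH]; first by rewrite muln0 !expr0 L1.
have -> : (2 * n.+1 = 2 * n + 2)%N by lia.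
(* The supremum says nothing at an [n] with [L (a ^+ (2 * n)) = 0]; there Cauchy-Schwarz for
   [a ^+ n] and [a ^+ n.+2] shows that the next even moment vanishes too. *)
have [L0|LN0] := eqVneq (L (a ^+ (2 * n))) 0.
  have := @weight_cauchy_schwarz _ _ L 1 (a ^+ n) (a ^+ n.+2).
  rewrite !mul1r -exprD -!exprM [(n * 2)%N]mulnC L0 mul0r => H.
  have /eqP : L (a ^+ (n + n.+2)) ^+ 2 == 0.
    by rewrite eq_le sqr_ge0 andbT; apply: H => x; rewrite mul1r; exact: psdL.
  move=> /eqP; rewrite sqrf_eq0 => /eqP.
  have -> : (n + n.+2 = 2 * n + 2)%N by lia.
  by move=> ->; rewrite exprn_ge0// fine_ge0// vE sqrte_ge0.
have Lp : 0 < L (a ^+ (2 * n)) by rewrite lt_def LN0 psd_even_ge0.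
have := Sn _ LN0; rewrite -v2 lee_fin ler_pdivrMr// => /le_trans; apply.
by rewrite exprD mulrC ler_wpM2r// sqr_ge0.
Qed.

Lemma psd_representation : (forall a, (vL L a < +oo)%E) ->
  exists (K : set {ptws A -> R}) (mu : {measure set (borel {ptws A -> R}) -> \bar R}),
    [/\ K `<=` characters A, compact K, radon_on K mu & is_representing_measure L K mu].
Proof.
move=> vfin; pose v a := fine (vL L a).
have v0 a : 0 <= v a by rewrite fine_ge0// sqrte_ge0.
have Lv x n : L (x ^+ (2 * n)) <= v x ^+ (2 * n) by exact: vL_growth.
pose K := bounded_characters v.
have KX : K `<=` characters A by move=> f [].
have Lpos b : (forall f, K f -> 0 <= evaluation b f) -> 0 <= L b.
  move=> bpos; rewrite leNgt; apply/negP => Lb.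
  (* The shift by [d] keeps [L (b + d)] negative, while [b + d] is strictly positive on [K]; the
     character found next contradicts this. *)
  pose d := - L b / 2.
  have d0 : 0 < d by rewrite divr_gt0// oppr_gt0.
  have Ld : L (b + d%:A) < 0.
    by rewrite linearD linearZ /= L1 mulr1 /d; lra.
  have [f [Xf fv]] := character_with_nonpos_value psdL v0 Lv Ld.
  have := bpos f (conj Xf fv); rewrite /evaluation => fb.
  rewrite (characterD Xf) (characterZ Xf) (character1 Xf) mulr1.
  by rewrite leNgt ltr_wpDl.
have cK : compact K by exact: bounded_characters_compact.
have [mu [muK muL]] := radon_representation ptws_hausdorff cK
  evaluation_continuous KX L1 Lpos.
by exists K, mu.
Qed.

End growth.

(** * The equivalences *)

Section moments.
Context {R : realType}.
Local Open Scope ereal_scope.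

Lemma horner_character (x : R) : characters {poly R} (fun p => p.[x]%R).
Proof.
by apply/charactersP; split=> [|r p q|p q]; rewrite ?hornerE.
Qed.

(** Points of the line are characters of the polynomial algebra, separated by the polynomial ['X],
    so the general uniqueness result applies. *)
Lemma moment_unique (K : set R) (mu nu : {measure set (borel R) -> \bar R}) :
  compact K -> radon_on K mu -> radon_on K nu ->
  (forall n, \int[mu]_(x in K) (x ^+ n)%:E = \int[nu]_(x in K) (x ^+ n)%:E) ->
  forall B : set (borel R), measurable B -> nu B = mu B.
Proof.
move=> cK muK nuK eq_mom.
have hR : hausdorff_space R by exact: Rhausdorff.
have mK : measurable (K : set (borel R)) by apply: borel_closed; exact: compact_closed.
pose ev (p : {poly R}) (x : R) := p.[x]%R.
have cev p : continuous (ev p) by exact: continuous_horner.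
apply: (@radon_on_unique R R {poly R} K ev) => //.
- by move=> x _; exact: horner_character.
- by move=> x y _ _ xy; exists 'X%R; rewrite /ev !hornerX.
move=> p.
have intE (la : {measure set (borel R) -> \bar R}) : radon_on K la ->
    \int[la]_(x in K) (ev p x)%:E =
    \sum_(i < size p) (p`_i)%:E * \int[la]_(x in K) (x ^+ i)%:E.
  move=> [[Kfin _] _].
  have intX i : la.-integrable K (EFin \o (fun x : R => x ^+ i)%R).
    by apply: continuous_integrable_on_compact => //; [exact: Kfin|exact: exprn_continuous].
  under eq_integral do rewrite /ev horner_coef -sumEFin.
  rewrite integral_sum//.
    apply: eq_bigr => i _; rewrite -(integralZl mK (intX i)).
    by apply: eq_integral => x _; rewrite EFinM.
  by move=> i; apply: (integrableZl mK _ (intX i)).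
rewrite !intE//; apply: eq_bigr => i _; congr (_ * _); exact: eq_mom.
Qed.

(** Inner regularity passes to the image measure because continuous images of compact sets are
    compact. *)
Lemma radon_pushforward (T : ptopologicalType) (K : set T) (phi : T -> R)
    (mu : {measure set (borel T) -> \bar R}) :
  hausdorff_space T -> compact K -> continuous phi -> radon_on K mu ->
  exists la : {measure set (borel R) -> \bar R}, radon_on (phi @` K) la /\
    forall n, \int[la]_(x in phi @` K) (x ^+ n)%:E =
              \int[mu]_(x in K) (phi x ^+ n)%:E.
Proof.
move=> hT cK cphi [[mufin muR] mu0].
have mK : measurable (K : set (borel T)) by apply: borel_closed; exact: compact_closed.
have mphi : measurable_fun setT (phi : borel T -> borel R).
  apply: (@measurability _ _ (borel T) (borel R) setT phi (@open R) erefl).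
  move=> _ [U oU <-].
  by rewrite setTI; apply: borel_open; apply: open_comp.
have cphiK : compact (phi @` K).
  by apply: continuous_compact => //; exact: continuous_subspaceT.
have mphiK : measurable (phi @` K : set (borel R)).
  by apply: borel_closed; apply: compact_closed => //; exact: Rhausdorff.
have mpre (B : set (borel R)) : measurable B -> measurable (phi @^-1` B : set (borel T)).
  by move=> mB; rewrite -[X in measurable X]setTI; exact: mphi.
have mutot : mu setT < +oo.
  have <- : mu K = mu setT.
    have : mu (K `|` ~` K) = mu K + mu (~` K).
      by rewrite measureU ?setICr//; exact: measurableC.
    by rewrite setUv mu0 adde0.
  exact: mufin.
have mule (B C : set (borel T)) : measurable B -> measurable C -> B `<=` C -> mu B <= mu C.
  by move=> mB mC BC; apply: le_measure => //; exact/mem_set.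
pose la : {measure set (borel R) -> \bar R} :=
  measure_function_pushforward__canonical__measure_function_Measure mu mphi.
have laE B : la B = mu (phi @^-1` B) by [].
have mcR (C : set R) : compact C -> measurable (C : set (borel R)).
  by move=> cC; apply: borel_closed; apply: compact_closed => //; exact: Rhausdorff.
exists la; split.
  split; last first.
    apply/eqP; rewrite eq_le measure_ge0 andbT -mu0 laE; apply: mule.
    - by apply: mpre; exact: measurableC.
    - exact: measurableC.
    - by move=> x nx Kx; apply: nx; exists x.
  split=> [C cC|B mB].
    by apply: le_lt_trans mutot; rewrite laE; apply: mule => //; apply: mpre; exact: mcR.
  apply/eqP; rewrite eq_le; apply/andP; split; last first.
    apply: ge_ereal_sup => _ [C [cC CB] <-]; rewrite !laE; apply: mule.
    - by apply: mpre; exact: mcR.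
    - exact: mpre.
    - by move=> x /CB.
  rewrite laE muR; last exact: mpre.
  apply: ge_ereal_sup => _ [C [cC CB] <-].
  have cphiC : compact (phi @` C).
    by apply: continuous_compact => //; exact: continuous_subspaceT.
  apply: (@le_trans _ _ (la (phi @` C))).
    rewrite laE; apply: mule.
    - by apply: borel_closed; exact: compact_closed.
    - by apply: mpre; exact: mcR.
    - by move=> x Cx; exists x.
  apply: ereal_sup_ubound; exists (phi @` C) => //; split=> // _ [x /CB Bx <-].
  exact: Bx.
move=> n.
have cX : continuous (fun x : R => x ^+ n)%R by exact: exprn_continuous.
have ccomp : continuous (fun x => phi x ^+ n)%R.
  by move=> x; apply: (continuous_comp (@cphi x) (@cX (phi x))).
have intD : mu.-integrable (phi @^-1` (phi @` K)) ((fun y : R => (y ^+ n)%:E) \o phi).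
  have [M M0 HM] := compact_bound cphiK cX.
  apply: (@measurable_bounded_integrable _ _ _ mu (fun x => phi x ^+ n)%R).
  - exact: mpre.
  - by apply: le_lt_trans mutot; apply: mule => //; exact: mpre.
  - exact: continuous_borel_measurable.
  exists M; split; first by rewrite num_real.
  by move=> y My x phix; apply: le_trans (ltW My); exact: (HM (phi x) phix).
rewrite (integral_pushforward mphi _ intD mphiK); last first.
  by apply/measurable_EFinP; exact: continuous_borel_measurable.
(* The preimage of the image of [K] may be larger than [K], but only by a set of measure zero. *)
rewrite (negligible_integral (N := ~` (K : set (borel T))))//; first last.
- exact: mpre.
- exact: measurableC.
by rewrite setDE setCK setIidr// => x Kx; exists x.
Qed.

End moments.

Section main.
Context {R : realType} {A : comAlgType R} (L : {scalar A}).
Hypothesis L1 : L 1 = 1.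

(** If [K] lies in [[-M, M]], then [x ^+ (2 * n + 2) <= M ^+ 2 * x ^+ (2 * n)] on [K]; integration
    gives [v_L(a) <= M]. *)
Lemma moment_measures_growth :
  (forall a : A, exists K : set R, compact K /\
    exists mu : {measure set (borel R) -> \bar R},
      unique_radon_on K (is_moment_measure L a K) mu) ->
  psd L /\ forall a : A, (vL L a < +oo)%E.
Proof.
move=> H.
have psdL : psd L.
  move=> a; have [K [cK [mu [_ mom _]]]] := H a.
  rewrite -lee_fin mom; apply: integral_ge0 => x Kx.
  by rewrite lee_fin sqr_ge0.
split=> // a; have [K [cK [mu [[[muR _] _] mom _]]]] := H a.
have [M M0 HM] := compact_bound cK (fun x => @cvg_id _ (nbhs (x : R))).
apply: le_lt_trans (_ : M%:E < +oo)%E; last by rewrite ltry.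
apply: vL_le => //; first exact: ltW.
move=> n; rewrite -lee_fin EFinM !mom.
have mK : measurable (K : set (borel R)).
  by apply: borel_closed; apply: compact_closed => //; exact: Rhausdorff.
have mX k : measurable_fun (K : set (borel R)) (fun x : borel R => ((x : R) ^+ k)%:E).
  by apply/measurable_EFinP; apply: continuous_borel_measurable; exact: exprn_continuous.
have even_ge0 (x : R) k : 0 <= x ^+ (2 * k) by rewrite mulnC exprM sqr_ge0.
rewrite -ge0_integralZl_EFin//; first 1 last.
- by move=> x _; rewrite lee_fin.
- exact: sqr_ge0.
apply: ge0_le_integral => //.
- by move=> x _; rewrite lee_fin -mulnSr even_ge0.
- by apply: measurable_funeM; exact: mX.
move=> x Kx; rewrite -EFinM lee_fin exprD mulrC ler_wpM2r//.
by rewrite -[x ^+ 2]real_normK ?num_real// lerXn2r ?nnegrE// ?HM// ltW.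
Qed.

(** The measure for [a] is the image of [mu] under evaluation at [a], carried by the compact image
    of [K]. *)
Lemma representation_pushforward
    (K : set {ptws A -> R}) (mu : {measure set (borel {ptws A -> R}) -> \bar R}) :
  unique_representation L K mu -> forall a : A, exists K : set R, compact K /\
    exists mu : {measure set (borel R) -> \bar R},
      unique_radon_on K (is_moment_measure L a K) mu.
Proof.
move=> [KX cK [muK rep _]] a.
have [la [laK lamom]] := radon_pushforward ptws_hausdorff cK
  (@evaluation_continuous _ _ a) muK.
have cKa : compact (evaluation a @` K).
  by apply: continuous_compact => //; apply: continuous_subspaceT; exact: evaluation_continuous.
exists (evaluation a @` K); split=> //; exists la.
have mom : is_moment_measure L a (evaluation a @` K) la.
  move=> n; rewrite rep lamom; apply: eq_integral => f /set_mem/KX Xf.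
  by rewrite (characterX Xf).
split=> // nu nuK numom; apply: moment_unique cKa laK nuK _ => n.
by rewrite -mom -numom.
Qed.

Lemma growth_representation : psd L -> (forall a : A, (vL L a < +oo)%E) ->
  exists (K : set {ptws A -> R}) (mu : {measure set (borel {ptws A -> R}) -> \bar R}),
    unique_representation L K mu.
Proof.
move=> psdL vfin.
have [K [mu [KX cK muK rep]]] := psd_representation L1 psdL vfin.
exists K, mu; split=> //; split=> // nu nuK nurep.
apply: (radon_on_unique ptws_hausdorff cK (ev := evaluation) _ KX) => //.
- exact: evaluation_continuous.
- move=> f g _ _ fg; apply: contrapT => nE; move/eqP: fg; apply.
  apply/funext => a; apply/eqP; apply: contrapT => /negP nfg.
  by apply: nE; exists a.
- by move=> a; rewrite -[LHS]rep -[RHS]nurep.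
Qed.

(** If [v < c < |f a|] with [v = v_L(a)], the open set [U] where [|g a| > c] contains [f], hence has
    positive measure. Then [c ^+ (2 * n)] times the measure of its part in [K] is at most
    [L (a ^+ (2 * n)) <= v ^+ (2 * n)] for all [n], which is impossible. *)
Lemma representation_support
    (K : set {ptws A -> R}) (mu : {measure set (borel {ptws A -> R}) -> \bar R}) :
  unique_representation L K mu ->
  msupport mu `<=` [set alpha | characters A alpha /\
                      forall a : A, (`|alpha a|%:E <= vL L a)%E].
Proof.
move=> [KX cK [[[muR _] mu0] rep _]] f fsupp.
have clK : closed K by apply: compact_closed => //; exact: ptws_hausdorff.
have mK : measurable (K : set (borel {ptws A -> R})) by exact: borel_closed.
have Kf : K f.
  apply: contrapT => nKf; have := fsupp (~` K) (closed_openC clK) nKf.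
  by rewrite mu0 ltxx.
split; first exact: KX.
move=> a; rewrite leNgt; apply/negP => vlt.
have psdL : psd L.
  move=> b; rewrite -lee_fin rep; apply: integral_ge0 => g Kg.
  by rewrite (characterX (KX _ Kg)) lee_fin sqr_ge0.
have vfin : (vL L a < +oo)%E by apply: lt_trans vlt _; rewrite ltry.
have v0 : (0 <= vL L a)%E by exact: sqrte_ge0.
have vf : vL L a \is a fin_num by rewrite ge0_fin_numE.
pose v := fine (vL L a).
have vv0 : 0 <= v by exact: fine_ge0.
have vf_lt : v < `|f a| by rewrite -lte_fin fineK.
pose c := (v + `|f a|) / 2.
have vc : v < c by rewrite /c; lra.
have cf : c < `|f a| by rewrite /c; lra.
have c0 : 0 < c by exact: le_lt_trans vc.
have cnorm : continuous (fun g : {ptws A -> R} => `|evaluation a g|).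
  move=> g.
  exact: (continuous_comp (@evaluation_continuous _ _ a g) (@norm_continuous _ R^o _)).
pose U := [set g : {ptws A -> R} | c < `|evaluation a g|].
have oU : open U.
  have -> : U = (fun g : {ptws A -> R} => `|evaluation a g|) @^-1` `]c, +oo[%classic.
    by apply/seteqP; split=> g; rewrite /U /= in_itv /= andbT.
  by apply: open_comp.
have mU : measurable (U : set (borel {ptws A -> R})) by exact: borel_open.
have mUK : measurable (U `&` K : set (borel {ptws A -> R})) by exact: measurableI.
have UKpos : (0 < mu (U `&` K))%E.
  apply: lt_le_trans (fsupp U oU cf) _.
  apply: (@le_trans _ _ (mu ((U `&` K) `|` ~` K))).
    apply: le_measure; [exact/mem_set|apply/mem_set|].
      by apply: measurableU => //; exact: measurableC.
    by move=> g Ug; have [Kg|nKg] := pselect (K g); [left|right].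
  apply: le_trans (measureU2 _ _ _) _ => //; first exact: measurableC.
  rewrite -[leRHS]adde0; apply: leeD => //.
  by rewrite le_eqVlt; apply/orP; left; apply/eqP.
have UKfin : mu (U `&` K) \is a fin_num.
  rewrite ge0_fin_numE//; apply: le_lt_trans (muR K cK).
  by apply: le_measure; [exact/mem_set|exact/mem_set|exact: subIsetr].
have H n : (c ^+ 2) ^+ n * fine (mu (U `&` K)) <= 1 * (v ^+ 2) ^+ n.
  rewrite mul1r -!exprM.
  apply: le_trans (vL_growth L1 psdL n vfin).
  rewrite -lee_fin EFinM fineK// rep -[mu _](integral_indic mu mK mU).
  rewrite -ge0_integralZl_EFin//; first 1 last.
  - by apply/measurable_EFinP; exact: measurable_indic.
  - by rewrite exprn_ge0 ?ltW.
  apply: ge0_le_integral => //.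
  - by move=> g _; apply: mule_ge0; rewrite lee_fin ?indicE ?ler0n// exprn_ge0 ?ltW.
  - by apply: measurable_funeM; apply/measurable_EFinP; exact: measurable_indic.
  - by apply/measurable_EFinP; apply: continuous_borel_measurable; exact: evaluation_continuous.
  move=> g Kg; rewrite (characterX (KX _ Kg)) -EFinM lee_fin indicE.
  have [Ug|_] := boolP (g \in U); last by rewrite mulr0 mulnC exprM sqr_ge0.
  rewrite mulr1 -[leRHS]ger0_norm; last by rewrite mulnC exprM sqr_ge0.
  have cg : c <= `|g a| := ltW (set_mem Ug).
  by rewrite normrX lerXn2r ?nnegrE// ltW.
have v2c2 : v ^+ 2 < c ^+ 2 by rewrite ltrXn2r ?nnegrE// ltW.
have := geometric_domination (sqr_ge0 v) v2c2 H.
by rewrite -lee_fin fineK// leNgt UKpos.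
Qed.

End main.

Theorem theorem5p2 (R : realType) (A : comAlgType R)
    (hX : characters A !=set0) (L : {scalar A}) (hL1 : L 1 = 1) :
  [<-> forall a : A, exists K : set R, compact K /\
         exists mu : {measure set (borel R) -> \bar R},
           unique_radon_on K (is_moment_measure L a K) mu;
       psd L /\ forall a : A, (vL L a < +oo)%E;
       exists (K : set {ptws A -> R})
         (mu : {measure set (borel {ptws A -> R}) -> \bar R}),
         unique_representation L K mu]
  /\
  (forall (K : set {ptws A -> R})
      (mu : {measure set (borel {ptws A -> R}) -> \bar R}),
    unique_representation L K mu ->
    msupport mu `<=`
      [set alpha | characters A alpha /\
                   forall a : A, (`|alpha a|%:E <= vL L a)%E]).
Proof.
split; last by move=> K mu; exact: representation_support.
tfae; first exact: moment_measures_growth.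
- by move=> [psdL vfin]; exact: growth_representation.
- by move=> [K [mu rep]]; exact: representation_pushforward rep.
Qed.
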